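(* Let $P$ satisfy the following micro–macro inequality: there exists a constant $c_{21}>0$ such that for every compact $K\subset\mathbb{R}^d$ there is $n_K\in\mathbb{N}$ with $$c_{21}\,n^{-1/d}\,h(x)^{-\frac{1}{r+d}}\ge d(x,\alpha_n)\qquad\text{for all } n\ge n_K,\ x\in K.$$ Then there are constants $c_{22},c_{23},c_{24},c_{25}>0$ such that, for every nonempty compact set $K\subset\mathbb{R}^d$, the following hold: $$\limsup_{n\to\infty}\ n\max_{a\in\alpha_n(K)}P(W(a\mid\alpha_n))\le c_{22}\Big(\inf_{\varepsilon>0}\|h\|_{K_\varepsilon}\Big)^{\frac{r}{r+d}},$$ $$\limsup_{n\to\infty}\ n^{1+r/d}\max_{a\in\alpha_n(K)}\int_{W(a\mid\alpha_n)}\|x-a\|^r\,dP(x)\le c_{23}\Big(1+\log\Big(\inf_{\varepsilon>0}\frac{\|h\|_{K_\varepsilon}}{\operatorname{essinf}h_{|K_\varepsilon}}\Big)\Big),$$ $$\liminf_{n\to\infty}\ n\min_{a\in\alpha_n(K)}P(W_0(a\mid\alpha_n))\ge c_{24}\sup_{\varepsilon>0}\big(\operatorname{essinf}h_{|K_\varepsilon}\big)^{\frac{r}{r+d}},$$ $$\liminf_{n\to\infty}\ n^{1+r/d}\min_{a\in\alpha_n(K)}\int_{W(a\mid\alpha_n)}\|x-a\|^r\,dP(x)\ge c_{25}\sup_{\varepsilon>0}\Big(\frac{\operatorname{essinf}h_{|K_\varepsilon}}{\|h\|_{K_\varepsilon}}\Big)^{\max(1,r)}.$$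
   Context: $\|\cdot\|$ is an arbitrary fixed norm on $\mathbb{R}^d$, $d\ge1$; $\lambda^d$ is Lebesgue measure; $d(x,A)=\inf_{a\in A}\|x-a\|$ with $d(x,\varnothing)=+\infty$. Fix $r\in(0,\infty)$. $P$ is an absolutely continuous Borel probability on $\mathbb{R}^d$ with density $h$, $\int\|x\|^{r+\delta}dP(x)<\infty$ for some $\delta>0$, and $h$ is bounded away from $0$ on compact sets: for every $\rho>0$ there is $c_\rho>0$ with $h(x)\ge c_\rho$ for all $\|x\|\le\rho$. For each $n\in\mathbb{N}$, $\alpha_n$ is an arbitrary fixed $n$-optimal codebook of order $r$ for $P$: $\operatorname{card}(\alpha_n)\le n$ and $\int d(x,\alpha_n)^r\,dP(x)=\inf\{\int d(x,\alpha)^r\,dP(x):\alpha\subset\mathbb{R}^d,\ 1\le\operatorname{card}(\alpha)\le n\}$ (it has exactly $n$ elements). For $a\in\alpha_n$: $W(a\mid\alpha_n)=\{x:\|x-a\|=d(x,\alpha_n)\}$, $W_0(a\mid\alpha_n)=\{x:\|x-a\|<d(x,\alpha_n\setminus\{a\})\}$. For compact $K$: $\alpha_n(K)=\{a\in\alpha_n: W(a\mid\alpha_n)\cap K\ne\varnothing\}$ and $K_\varepsilon=\{y\in\mathbb{R}^d:d(y,K)\le\varepsilon\}$. $\|h\|_B=\operatorname{esssup}h_{|B}$ and $\operatorname{essinf}$ are taken with respect to $\lambda^d$ (if $\|h\|_B=+\infty$, upper bounds are read as $+\infty$ and the ratio $\operatorname{essinf}/\|h\|_B$ as $0$). *)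

(* Defs.v *)
From HB Require Import structures.
From mathcomp Require Import all_boot all_order all_algebra finmap.
From mathcomp Require Import all_classical all_reals all_analysis.
From mathcomp Require Import measurable_realfun ess_sup_inf.

Set Implicit Arguments.
Unset Strict Implicit.
Unset Printing Implicit Defensive.

Import Order.TTheory GRing.Theory Num.Theory.
Import numFieldNormedType.Exports.

Local Open Scope classical_set_scope.
Local Open Scope ring_scope.

(* The canonical topology of 'rV[R]_d is the one of the sup norm, which is the
   topology of every norm on R^d; so [open] and [compact] below do not depend
   on the norm [N]. *)
HB.instance Definition _ (R : realType) (d : nat) :=
  Measurable.copy 'rV[R]_d (g_sigma_algebraType (@open 'rV[R]_d)).

Section borel_rV.
Context (R : realType).

Lemma measurable_rV_open d (U : set 'rV[R]_d) : open U -> measurable U.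
Proof. by move=> oU; apply: sub_sigma_algebra. Qed.

Lemma measurable_rV_coord d (i : 'I_d) :
  measurable_fun setT (fun x : 'rV[R]_d => x ord0 i : measurableTypeR R).
Proof.
apply: (measurability _ (RGenOpens.measurableE R)) => _ [_ [a [b ->]] <-].
rewrite setTI; apply: measurable_rV_open.
apply: open_comp; last exact: interval_open.
by move=> x _; exact: coord_continuous.
Qed.

Lemma measurable_fun_rV dT (T : measurableType dT) d (f : T -> 'rV[R]_d) :
  (forall i, measurable_fun setT (fun t => f t ord0 i : measurableTypeR R)) ->
  measurable_fun setT f.
Proof.
move=> mf.
apply: (@measurability _ _ _ _ _ f (@open 'rV[R]_d)) => //.
move=> _ [U oU <-]; rewrite setTI.
pose B (p : 'rV[rat]_d * rat) : set 'rV[R]_d :=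
  [set x | forall i, `|ratr (p.1 ord0 i) - x ord0 i| < ratr p.2].
have -> : U = \bigcup_p (if `[< B p `<=` U >] then B p else set0).
  rewrite eqEsubset; split => [x Ux|x [p _]]; last first.
    by case: asboolP => // pU /pU.
  have /nbhs_ballP[e /= e0 eU] : nbhs x U by apply: open_nbhs_nbhs.
  have [q] := @rat_in_itvoo R 0 (e / 2) (divr_gt0 e0 (ltr0Sn _ _)).
  rewrite in_itv/= => /andP[q0 qe].
  have xq i : exists s : rat, `|ratr s - x ord0 i| < ratr q.
    have [|s] := @rat_in_itvoo R (x ord0 i - ratr q) (x ord0 i + ratr q).
      by rewrite ltrD2l gtrN.
    by rewrite in_itv/= -ltr_distl => H; exists s.
  have [s sP] := choice xq.
  exists (\row_i s i, q) => //.
  case: asboolP => [_ i|[]]; first by rewrite mxE.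
  move=> y By; apply: eU; split=> // i j; rewrite ord1 /ball/=.
  have := By j; have := sP j; rewrite /= mxE => H1 H2.
  rewrite -(subrKA (ratr (s j))) (le_lt_trans (ler_normD _ _))//.
  rewrite (splitr e) ltrD//; last exact: lt_trans qe.
  by rewrite distrC (lt_trans H1).
rewrite preimage_bigcup; apply: countable_bigcupT_measurable => // p.
case: asboolP => _; last by rewrite preimage_set0.
rewrite (_ : _ @^-1` _ = \bigcap_(i in [set: 'I_d])
  ((fun t => f t ord0 i) @^-1` ball (ratr (p.1 ord0 i) : R) (ratr p.2))).
  apply: fin_bigcap_measurable => [|i _]; first exact: finite_finset.
  rewrite -[X in measurable X]setTI; apply: mf => //.
  exact: measurable_ball.
by apply/seteqP; split => t /= H i; [move=> _|]; exact: H.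
Qed.

End borel_rV.

Section lebesgue_rV_step.
Context (R : realType) (d : nat).

Definition rV_cons (p : measurableTypeR R * 'rV[R]_d) : 'rV[R]_d.+1 :=
  row_mx (const_mx p.1 : 'rV_1) p.2.

Definition rV_uncons (x : 'rV[R]_d.+1) : measurableTypeR R * 'rV[R]_d :=
  (x ord0 ord0, \row_j x ord0 (lift ord0 j)).

Lemma rV_consE p i :
  rV_cons p ord0 i = if unlift ord0 i is Some j then p.2 ord0 j else p.1.
Proof.
case: unliftP => [j ->|->].
  by rewrite -[RHS](row_mxEr (const_mx p.1 : 'rV_1)); congr (row_mx _ _ _ _);
    exact: val_inj.
rewrite (_ : ord0 = lshift d (ord0 : 'I_1)); last exact: val_inj.
by rewrite [LHS]row_mxEl mxE.
Qed.

Lemma rV_consK : cancel rV_cons rV_uncons.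
Proof.
move=> [t x]; rewrite /rV_uncons rV_consE unlift_none/=.
by have -> : \row_j rV_cons (t, x) ord0 (lift ord0 j) = x
  by apply/rowP => j; rewrite mxE rV_consE liftK.
Qed.

Lemma measurable_rV_cons : measurable_fun setT rV_cons.
Proof.
apply: measurable_fun_rV => i.
rewrite (_ : (fun _ => _) = fun p : measurableTypeR R * 'rV[R]_d =>
    if unlift ord0 i is Some j then p.2 ord0 j else p.1); last first.
  by apply/funext => p; rewrite rV_consE.
case: (unlift _ _) => [j|]; last exact: measurable_fst.
by apply: (measurableT_comp (measurable_rV_coord j)); exact: measurable_snd.
Qed.

Lemma measurable_rV_uncons : measurable_fun setT rV_uncons.
Proof.
apply/measurable_fun_pairP; split; first exact: measurable_rV_coord.
apply: measurable_fun_rV => j.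
rewrite (_ : (fun _ => _) = fun x : 'rV[R]_d.+1 => x ord0 (lift ord0 j)).
  exact: measurable_rV_coord.
by apply/funext => x; rewrite /= mxE.
Qed.

Local Open Scope ereal_scope.
Variable mu : {sigma_finite_measure set 'rV[R]_d -> \bar R}.

Definition lebesgue_rV_step : set 'rV[R]_d.+1 -> \bar R :=
  pushforward (@lebesgue_measure R \x mu) rV_cons.

Let step0 : lebesgue_rV_step set0 = 0.
Proof. by rewrite /lebesgue_rV_step /pushforward preimage_set0 measure0. Qed.

Let step_ge0 A : 0 <= lebesgue_rV_step A.
Proof. exact: (measure_ge0 (@lebesgue_measure R \x mu)). Qed.

Let step_sigma_additive : semi_sigma_additive lebesgue_rV_step.
Proof.
exact: (@measure_semi_sigma_additive _ _ _
  (measure_function_pushforward__canonical__measure_function_Measure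
     (@lebesgue_measure R \x mu) measurable_rV_cons)).
Qed.

HB.instance Definition _ := isMeasure.Build _ _ _ lebesgue_rV_step
  step0 step_ge0 step_sigma_additive.

Let step_sigma_finite : sigma_finite setT lebesgue_rV_step.
Proof.
have /sigma_finiteP[F [FT ndF Foo]] := sigma_finiteT (@lebesgue_measure R).
have /sigma_finiteP[G [GT ndG Goo]] := sigma_finiteT mu.
exists (fun n => rV_uncons @^-1` (F n `*` G n)).
  rewrite -preimage_bigcup -[LHS](preimage_setT rV_uncons); congr (_ @^-1` _).
  apply/esym/seteqP; split => // -[t x] _.
  have [i _ Fi] : (\bigcup_i F i) t by rewrite -FT.
  have [j _ Gj] : (\bigcup_j G j) x by rewrite -GT.
  exists (maxn i j) => //; split.
    exact: (subsetPset _ _ (ndF _ _ (leq_maxl i j))).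
  exact: (subsetPset _ _ (ndG _ _ (leq_maxr i j))).
move=> n; have [mF Fn] := Foo n; have [mG Gn] := Goo n; split.
  rewrite -[X in measurable X]setTI; apply: measurable_rV_uncons => //.
  exact: measurableX.
rewrite /lebesgue_rV_step /pushforward -comp_preimage.
rewrite (_ : _ \o _ = id); last by apply/funext => p; exact: rV_consK.
by rewrite preimage_id product_measure1E// lte_mul_pinfty// ge0_fin_numE.
Qed.

HB.instance Definition _ := Measure_isSigmaFinite.Build _ _ _ lebesgue_rV_step
  step_sigma_finite.

End lebesgue_rV_step.

Fixpoint lebesgue_rV (R : realType) (d : nat) :
    {sigma_finite_measure set 'rV[R]_d -> \bar R} :=
  if d is d'.+1 then lebesgue_rV_step (lebesgue_rV R d') else dirac (0 : 'rV[R]_0).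

Lemma measurable_rV_box (R : realType) (d : nat) (A : 'I_d -> set R) :
  (forall i, measurable (A i : set (measurableTypeR R))) ->
  measurable [set x : 'rV[R]_d | forall i, A i (x ord0 i)].
Proof.
move=> mA.
have -> : [set x : 'rV[R]_d | forall i, A i (x ord0 i)] =
    \bigcap_(i in [set: 'I_d]) ((fun x : 'rV[R]_d => x ord0 i) @^-1` A i).
  by apply/seteqP; split => x /= H i; [move=> _|]; exact: H.
apply: fin_bigcap_measurable => [|i _]; first exact: finite_finset.
by rewrite -[X in measurable X]setTI; exact: measurable_rV_coord.
Qed.

Lemma lebesgue_rV_box (R : realType) (d : nat) (A : 'I_d -> set R) :
  (forall i, measurable (A i : set (measurableTypeR R))) ->
  lebesgue_rV R d [set x | forall i, A i (x ord0 i)] =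
  (\prod_(i < d) lebesgue_measure (A i))%E.
Proof.
elim: d A => [|d IH] A mA.
  by rewrite big_ord0 /= diracE mem_set// => -[].
rewrite big_ord_recl -IH// -product_measure1E//; last first.
  exact: (@measurable_rV_box _ _ (fun i => A (lift ord0 i))).
congr (product_measure1 _ _ _); apply/seteqP; split => -[t x] /=.
  move=> H; split=> [|i]; first by have := H ord0; rewrite rV_consE unlift_none.
  by have := H (lift ord0 i); rewrite rV_consE liftK.
move=> [At Ax] i; rewrite rV_consE.
by case: unliftP => [j ->|->] //=; exact: Ax.
Qed.

Section quantization.
Context (R : realType) (d : nat).
Implicit Types (N : 'rV[R]_d -> R) (A B K : set 'rV[R]_d) (x a : 'rV[R]_d).
Implicit Types (alpha beta : {fset 'rV[R]_d}) (P : probability 'rV[R]_d R).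
Implicit Types (h : 'rV[R]_d -> R) (r e : R) (n : nat).

Record is_norm N : Prop := IsNorm {
  norm_ge0 : forall x, 0 <= N x;
  norm_eq0 : forall x, N x = 0 -> x = 0;
  norm_scale : forall (t : R) x, N (t *: x) = `|t| * N x;
  norm_triangle : forall x y, N (x + y) <= N x + N y }.

Record is_density P h : Prop := IsDensity {
  density_measurable :
    measurable_fun setT (h : 'rV[R]_d -> measurableTypeR R);
  density_ge0 : forall x, 0 <= h x;
  densityE : forall A, measurable A ->
    P A = (\int[lebesgue_rV R d]_(x in A) (h x)%:E)%E }.

Local Open Scope ereal_scope.

(* [+oo] when [A] is empty *)
Definition dist N x A : \bar R := ereal_inf [set (N (x - a))%:E | a in A].

Definition distortion N r P alpha : \bar R :=
  \int[P]_x (dist N x [set` alpha] `^ r).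

Definition is_optimal_codebook N r P n alpha : Prop :=
  (#|` alpha| <= n)%N /\
  distortion N r P alpha = ereal_inf
    [set distortion N r P beta | beta in [set beta | (1 <= #|` beta| <= n)%N]].

Definition voronoi N a alpha : set 'rV[R]_d :=
  [set x | (N (x - a))%:E = dist N x [set` alpha]].

Definition open_voronoi N a alpha : set 'rV[R]_d :=
  [set x | (N (x - a))%:E < dist N x ([set` alpha] `\ a)].

Definition codebook_on N alpha K : {fset 'rV[R]_d} :=
  [fset a in alpha | `[< voronoi N a alpha `&` K !=set0 >]]%fset.

Definition closed_nbhd N K e : set 'rV[R]_d := [set y | dist N y K <= e%:E].

(* Outside [B] the function is replaced by the neutral value of the supremum
   (resp. infimum), so that only the values on [B] count. *)
Definition ess_sup_on B h : \bar R :=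
  ess_sup (lebesgue_rV R d) (patch (cst -oo) B (EFin \o h)).

Definition ess_inf_on B h : \bar R :=
  ess_inf (lebesgue_rV R d) (patch (cst +oo) B (EFin \o h)).

Definition cell_inertia N r P a alpha : \bar R :=
  \int[P]_(x in voronoi N a alpha) (N (x - a) `^ r)%:E.

End quantization.

(* Main.v *)
Require Import Defs.
From HB Require Import structures.
From mathcomp Require Import all_boot all_order all_algebra finmap.
From mathcomp Require Import all_classical all_reals all_analysis.
From mathcomp Require Import measurable_realfun ess_sup_inf.
From mathcomp Require Import ring lra.

Set Implicit Arguments.
Unset Strict Implicit.
Unset Printing Implicit Defensive.

Import Order.TTheory GRing.Theory Num.Theory.
Import numFieldNormedType.Exports.

Local Open Scope classical_set_scope.
Local Open Scope ring_scope.

(** All four bounds concern the cell of a point [a] of the codebook when it meets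
    the compact set [K], and they rest on three points.

    Geometry ([cell_geometry]). If [h >= m] almost everywhere near [K], the
    micro-macro inequality keeps the distance to the codebook near [K] below
    [2 D], where [D = c n^(-1/d) m^(-1/(r+d))]. Voronoi cells are star-shaped with
    respect to their centre ([voronoi_star]), so a cell that meets [K] cannot leave
    the ball of radius [3 D] around [a]; hence it stays near [K] for large [n]. A
    point at distance [3 D] from [a] belongs to another cell, so some other
    codebook point lies within [5 D] of [a].

    Upper bounds ([mass_upper], [inertia_upper]). On the cell, the micro-macro
    inequality, solved for the density, gives [h x <= (u / N (x - a))^(r+d)] with
    [u = c n^(-1/d)]; near [K] one also has [h <= H]. Both bounds agree at the
    radius [rho = u H^(-1/(r+d))]. Over the dyadic shells
    [2^k rho < N (x - a) <= 2^(k+1) rho], the masses decrease like [2^(-kr)], and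
    their sum is of order [H rho^d], that is [n^(-1) H^(r/(r+d))]. The inertias of
    the shells are all bounded by the same multiple of [u^(r+d)], that is of
    [n^(-(1+r/d))], and it takes at most a multiple of [1 + log (H/m)] shells to cover
    the cell.

    Lower bounds ([mass_lower], [inertia_lower]). The balls of radius [s] around
    [n - 1] points do not cover the unit ball when [s] is a small multiple of
    [n^(-1/d)]. Adding an uncovered point to the optimal codebook of size [n - 1]
    decreases the distortion by the order of [s^(r+d)] ([distortion_gain]). By
    optimality this decrease is at most the cost of removing [a] from the optimal
    codebook of size [n], and that cost is at most [(8 D)^r] times the mass of the
    open cell ([open_voronoi_mass]). This bounds the mass of the open cell from
    below. As [h <= H] near [K], at least half of this mass lies outside a small ball
    around [a], and this bounds the inertia from below.

    The constants do not depend on the neighbourhood of [K]. In the upper bounds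
    the infimum over neighbourhoods is positive, so it is within a factor 2 of its
    value at some neighbourhood, and this factor is absorbed by the constants. *)

(** * Real powers and logarithms *)

Lemma powR_le1 (R : realType) (x p : R) : 0 <= x <= 1 -> 0 <= p -> x `^ p <= 1.
Proof.
move=> /andP[x0 x1] p0; have := @ge0_ler_powR R p p0 x 1.
by rewrite powR1 !nnegrE x0 x1 ler01; exact.
Qed.

Lemma powR_half_lt1 (R : realType) (r : R) : 0 < r -> (2^-1 : R) `^ r < 1.
Proof.
move=> r0; have := @gt0_ltr_powR R r r0 2^-1 1; rewrite powR1 !nnegrE.
by apply; rewrite ?invr_ge0 ?ler0n ?ler01 ?invf_lt1 ?ltr1n ?ltr0n.
Qed.

Lemma powRX (R : realType) (x r : R) n : 0 <= x -> (x ^+ n) `^ r = (x `^ r) ^+ n.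
Proof.
move=> x0.
by rewrite -(powR_mulrn n x0) -(powR_mulrn n (powR_ge0 x r)) powRAC.
Qed.

Lemma powRV (R : realType) (x r : R) : 0 <= x -> x^-1 `^ r = (x `^ r)^-1.
Proof. by move=> x0; rewrite -(powR_inv1 x0) -powRrM mulN1r powRN. Qed.

Lemma lee_half (R : realType) (y w : R) :
  (y%:E <= (y / 2)%:E + w%:E -> (y / 2)%:E <= w%:E)%E.
Proof. by rewrite -EFinD !lee_fin; lra. Qed.

(** With [y = x^(1/(r+d))], the powers of [x] that occur in the estimates are products
    of integer powers of [y] and of [y `^ r], so that the exponent bookkeeping
    becomes field arithmetic. *)
Lemma root_split (R : realType) (r : R) d (x : R) : 0 < r -> 0 < x ->
  let y := x `^ (1 / (r + d%:R)) in
  [/\ 0 < y, x = y ^+ d * y `^ r, x `^ (- (1 / (r + d%:R))) = y^-1 &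
      x `^ (r / (r + d%:R)) = y `^ r].
Proof.
move=> r0 x0 y; have p0 : 0 < r + d%:R by rewrite ltr_wpDr.
have y0 : 0 < y by rewrite powR_gt0.
split => //; last 2 first.
- by rewrite powRN.
- by rewrite /y -powRrM mulrAC mul1r.
rewrite -powR_mulrn ?ltW// -powRD; last by rewrite (gt_eqF y0) implybT.
by rewrite /y -powRrM [d%:R + r]addrC div1r mulVf ?gt_eqF// powRr1// ltW.
Qed.

Lemma nat_root_split (R : realType) (r : R) d n : 0 < r -> (1 <= d)%N -> (1 <= n)%N ->
  let y : R := n%:R `^ (1 / d%:R) in
  [/\ 0 < y, n%:R = y ^+ d, n%:R `^ (- (1 / d%:R)) = y^-1 &
      n%:R `^ (1 + r / d%:R) = y ^+ d * y `^ r].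
Proof.
move=> r0 d1 n1 y; have n0 : (0 : R) < n%:R by rewrite ltr0n.
have d0 : (0 : R) < d%:R by rewrite ltr0n.
have y0 : 0 < y by rewrite powR_gt0.
have e : n%:R = y ^+ d.
  by rewrite -powR_mulrn ?ltW// /y -powRrM div1r mulVf ?gt_eqF// powRr1// ltW.
split => //; first by rewrite powRN.
rewrite powRD; last by rewrite (gt_eqF n0) implybT.
rewrite powRr1 ?ler0n// -e; congr (_ * _).
by rewrite /y -powRrM mulrAC mul1r.
Qed.

(** A power of two above [x] whose exponent is logarithmic in [x]. *)
Lemma log2_choice (R : realType) (x : R) : 1 <= x ->
  exists M : nat, x <= 2 ^+ M /\ M%:R <= ln x / ln 2 + 1.
Proof.
move=> x1; have x0 : 0 < x by rewrite (lt_le_trans ltr01).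
have l2 : 0 < ln (2 : R) by rewrite ln_gt0// ltr1n.
have L0 : 0 <= ln x / ln 2 by rewrite divr_ge0 ?ln_ge0 ?ler1n.
exists (Num.truncn (ln x / ln 2)).+1; split; last first.
  by rewrite -natr1 lerD2r; have /andP[] := truncn_itv L0.
rewrite -ler_ln ?posrE ?exprn_gt0// lnXn// -(mulr_natl (ln 2)) -ler_pdivrMr//.
by rewrite ltW// truncnS_gt.
Qed.

(** * Norms on row vectors *)

Section norm_facts.
Context (R : realType) (d : nat).
Implicit Types (N : 'rV[R]_d -> R) (x y a : 'rV[R]_d).

Lemma normN0 N (N_norm : is_norm N) : N 0 = 0.
Proof. by rewrite -(scale0r 0) (norm_scale N_norm) normr0 mul0r. Qed.

Lemma normNN N (N_norm : is_norm N) x : N (- x) = N x.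
Proof. by rewrite -scaleN1r (norm_scale N_norm) normrN1 mul1r. Qed.

Lemma normNC N (N_norm : is_norm N) x y : N (x - y) = N (y - x).
Proof. by rewrite -(normNN N_norm) opprB. Qed.

Lemma normN_tri N (N_norm : is_norm N) y x a : N (x - a) <= N (x - y) + N (y - a).
Proof. by rewrite (le_trans _ (norm_triangle N_norm _ _))// addrA subrK. Qed.

(** Every norm is bounded by a multiple of the sup norm. *)
Lemma normN_le_sup N (N_norm : is_norm N) :
  exists2 C : R, 0 < C & forall x, N x <= C * `|x|.
Proof.
pose C := 1 + \sum_(i < d) N (delta_mx 0 i).
have C0 : 0 < C by rewrite ltr_wpDr// sumr_ge0// => i _; exact: norm_ge0.
exists C => // x.
have sub (I : eqType) (s : seq I) (F : I -> 'rV[R]_d) :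
    N (\sum_(i <- s) F i) <= \sum_(i <- s) N (F i).
  elim: s => [|i s IH]; first by rewrite !big_nil (normN0 N_norm).
  by rewrite !big_cons (le_trans (norm_triangle N_norm _ _))// lerD2l.
rewrite [in leLHS](row_sum_delta x) (le_trans (sub _ _ _))//.
rewrite /C mulrDl mul1r -[leLHS]add0r lerD// mulr_suml ler_sum// => i _.
rewrite (norm_scale N_norm) mulrC ler_wpM2l ?norm_ge0//.
by rewrite [in leRHS]/Num.norm/= mx_normrE (bigmaxD1 (ord0, i))//= le_max lexx.
Qed.

(** A function that is 1-Lipschitz for [N] is continuous. *)
Lemma continuous_lipN N (N_norm : is_norm N) (f : 'rV[R]_d -> R) :
  (forall x y, f x <= N (x - y) + f y) -> continuous f.
Proof.
move=> lip x; have [C C0 NC] := normN_le_sup N_norm.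
apply/(@cvgrPdist_lt _ _ _ _ (nbhs_filter x)) => e e0.
apply/nbhs_ballP; exists (e / C) => /=; first exact: divr_gt0.
move=> y; rewrite mx_norm_ball /ball_/= => xy.
have Nxy : `|f x - f y| <= N (x - y).
  rewrite ler_norml; apply/andP; split; last by rewrite lerBlDr lip.
  by have := lip y x; rewrite (normNC N_norm); lra.
rewrite (le_lt_trans Nxy)// (le_lt_trans (NC _))//.
by rewrite -ltr_pdivlMl// mulrC.
Qed.

Lemma continuous_normN N (N_norm : is_norm N) : continuous N.
Proof.
apply: (continuous_lipN N_norm) => x y.
by rewrite -[x in leLHS](subrK y) (norm_triangle N_norm).
Qed.

(** The other half of the equivalence of norms: a norm attains a positive
    minimum on the sup-norm unit sphere, which is compact. *)
Lemma sup_le_normN N (N_norm : is_norm N) :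
  exists2 C : R, 0 < C & forall x, `|x| <= C * N x.
Proof.
pose S := [set x : 'rV[R]_d | `|x| = 1].
have [S0|Sn] := pselect (S !=set0); last first.
  exists 1 => // x; have [->|x0] := eqVneq x 0.
    by rewrite normr0 mul1r norm_ge0.
  exfalso; apply: Sn; exists (`|x|^-1 *: x); rewrite /S /=.
  by rewrite normrZ normfV normr_id mulVf// normr_eq0.
have cS : compact S.
  apply: bounded_closed_compact.
    by exists 1; split => // y y1 x /= ->; exact: ltW.
  by apply: (@closed_comp _ _ (fun x : 'rV[R]_d => `|x|) [set 1]);
    [move=> x _; exact: norm_continuous|exact: closed_eq].
have cN : {within S, continuous N}.
  exact/continuous_subspaceT/continuous_normN.
have [z zS zmin] := EVT_min_rV S0 cS cN.
have Sz : S z by rewrite inE in zS.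
have Nz0 : 0 < N z.
  rewrite lt_neqAle norm_ge0// andbT eq_sym; apply/eqP => /(norm_eq0 N_norm) z0.
  by move: Sz; rewrite z0 /S/= normr0 => /esym/eqP; rewrite oner_eq0.
exists (N z)^-1; first by rewrite invr_gt0.
move=> x; have [->|x0] := eqVneq x 0.
  by rewrite normr0 mulr_ge0// ?invr_ge0 ?norm_ge0.
have nx0 : 0 < `|x| by rewrite normr_gt0.
have : N z <= N (`|x|^-1 *: x).
  apply: zmin; rewrite inE /S /= normrZ normfV normr_id mulVf//.
  by rewrite gt_eqF.
rewrite (norm_scale N_norm) normfV normr_id ler_pdivlMl//.
by rewrite mulrC ler_pdivlMl// mulrC.
Qed.

(** The closed ball of centre [a] and radius [s] for the norm [N]. *)
Definition ballN N a (s : R) : set 'rV[R]_d := [set x | N (x - a) <= s].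

Lemma continuous_ndist N (N_norm : is_norm N) a : continuous (fun x => N (x - a)).
Proof.
move=> x; apply: (@continuous_comp _ _ _ (fun x => x - a) N).
  by apply: continuousB; [exact: cvg_id|exact: cst_continuous].
exact: continuous_normN.
Qed.

Lemma closed_ballN N (N_norm : is_norm N) a s : closed (ballN N a s).
Proof.
apply: (@closed_comp _ _ (fun x => N (x - a)) [set t | t <= s]) => [x _|].
  exact: continuous_ndist.
exact: closed_le.
Qed.

Lemma measurable_ballN N (N_norm : is_norm N) a s : measurable (ballN N a s).
Proof.
rewrite -[X in measurable X]setCK; apply: measurableC.
by apply: measurable_rV_open; rewrite openC; exact: closed_ballN.
Qed.

Lemma compact_ballN N (N_norm : is_norm N) a s : compact (ballN N a s).
Proof.
apply: bounded_closed_compact; last exact: closed_ballN.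
have [C C0 NC] := sup_le_normN N_norm.
exists (C * (s + N a)); split; first exact: num_real.
move=> M sM x /= xs; apply/ltW; rewrite (le_lt_trans (NC _))//.
rewrite (le_lt_trans _ sM)// ler_pM2l// -[x in leLHS](subrK a).
by rewrite (le_trans (norm_triangle N_norm _ _))// lerD2r.
Qed.

(** Volumes of [N]-balls are comparable with the [d]-th power of the radius:
    such a ball lies between two cubes. *)
Lemma lebesgue_ballN N (N_norm : is_norm N) :
  exists k : R * R, [/\ 0 < k.1, 0 < k.2 & forall a s, 0 <= s ->
    ((k.1 * s ^+ d)%:E <= lebesgue_rV R d (ballN N a s) <= (k.2 * s ^+ d)%:E)%E].
Proof.
pose Q a (s : R) := [set x : 'rV[R]_d | forall i, `[a ord0 i - s, a ord0 i + s]%classic (x ord0 i)].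
have Qx a s x : 0 <= s -> Q a s x <-> `|x - a| <= s.
  move=> s0; split=> H.
    rewrite /Num.norm/= mx_normrE; apply: bigmax_le => // -[j i] _ /=.
    by rewrite ord1 !mxE; have := H i; rewrite /= in_itv/= ler_distl.
  move=> i /=; rewrite in_itv/= -ler_distl.
  apply: le_trans H; rewrite [in leRHS]/Num.norm/= mx_normrE.
  by rewrite (bigmaxD1 (ord0, i))//= !mxE le_max lexx.
have mQ a s : measurable (Q a s).
  apply: (@measurable_rV_box _ _ (fun i => `[a ord0 i - s, a ord0 i + s]%classic)) => i.
  exact: measurable_itv.
have lQ a s : 0 <= s -> lebesgue_rV R d (Q a s) = ((2 * s) ^+ d)%:E.
  move=> s0; rewrite (@lebesgue_rV_box _ _ (fun i => `[a ord0 i - s, a ord0 i + s]%classic))//.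
  rewrite (eq_bigr (fun=> (2 * s)%:E)); last first.
    move=> i _; rewrite lebesgue_measure_itv/= lte_fin.
    case: ifPn => [_|]; first by rewrite -EFinB; congr EFin; ring.
    rewrite -leNgt => h; congr EFin; lra.
  by rewrite prodEFin big_const_ord iter_mulr_1.
have [C1 C10 NC1] := normN_le_sup N_norm.
have [C2 C20 NC2] := sup_le_normN N_norm.
exists ((2 / C1) ^+ d, (2 * C2) ^+ d); split => [||a s s0] /=.
- by rewrite exprn_gt0// divr_gt0.
- by rewrite exprn_gt0// mulr_gt0.
rewrite -!exprMn; apply/andP; split.
  have s1 : 0 <= s / C1 by rewrite divr_ge0// ltW.
  rewrite (_ : 2 / C1 * s = 2 * (s / C1)); last by ring.
  rewrite -(lQ a)//; apply: le_measure; rewrite ?inE//.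
    exact: measurable_ballN.
  move=> x /(Qx _ _ _ s1) h; rewrite /ballN/= (le_trans (NC1 _))//.
  by rewrite -ler_pdivlMl// mulrC.
have s1 : 0 <= C2 * s by rewrite mulr_ge0// ltW.
rewrite -mulrA -(lQ a)//; apply: le_measure; rewrite ?inE//.
  exact: measurable_ballN.
move=> x h; apply/Qx => //; rewrite (le_trans (NC2 _))//.
by rewrite ler_pM2l.
Qed.

End norm_facts.

(** * Distance to a codebook *)

Section distance.
Context (R : realType) (d : nat) (N : 'rV[R]_d -> R) (N_norm : is_norm N).
Implicit Types (x y a b : 'rV[R]_d) (alpha : {fset 'rV[R]_d}).

(** The distance to a codebook as a real number; it is [0], and not
    [+oo], when the codebook is empty. *)
Definition distR alpha x : R := fine (dist N x [set` alpha]).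

Lemma distR_spec alpha x : alpha != fset0 ->
  exists2 a, a \in alpha & [/\ dist N x [set` alpha] = (N (x - a))%:E,
    distR alpha x = N (x - a) & forall b, b \in alpha -> N (x - a) <= N (x - b)].
Proof.
move=> /fset0Pn[c ca].
have mins (s : seq 'rV[R]_d) : c \in s ->
    exists2 a, a \in s & forall b, b \in s -> N (x - a) <= N (x - b).
  elim: s c {ca} => // e s IH c _; case: s IH => [_|f s IH].
    by exists e; rewrite ?mem_head// => b; rewrite inE => /eqP ->.
  have [a' as' amin] := IH f (mem_head _ _).
  have [ea|ae] := leP (N (x - e)) (N (x - a')).
    exists e; rewrite ?mem_head// => b; rewrite inE => /predU1P[->//|bs].
    by rewrite (le_trans ea)// amin.
  exists a'; first by rewrite inE as' orbT.
  by move=> b; rewrite inE => /predU1P[->|bs]; [exact: ltW|exact: amin].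
have [a aa amin] := mins _ ca; exists a => //.
suff e : dist N x [set` alpha] = (N (x - a))%:E by rewrite /distR e.
apply/eqP; rewrite eq_le; apply/andP; split.
  by apply: ereal_inf_lbound; exists a.
by apply: le_ereal_inf_tmp => _ [b /= ba <-]; rewrite lee_fin amin.
Qed.

Lemma distRE alpha x : alpha != fset0 ->
  dist N x [set` alpha] = (distR alpha x)%:E.
Proof. by move=> /distR_spec-/(_ x)[a _ [-> -> _]]. Qed.

Lemma distR_le alpha x b : b \in alpha -> distR alpha x <= N (x - b).
Proof.
move=> ba; have a0 : alpha != fset0 by apply/fset0Pn; exists b.
by have [a _ [_ -> amin]] := distR_spec x a0; exact: amin.
Qed.

Lemma le_distR alpha x t : alpha != fset0 ->
  (forall b, b \in alpha -> t <= N (x - b)) -> t <= distR alpha x.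
Proof. by move=> /distR_spec-/(_ x)[a aa [_ -> _]]; apply. Qed.

Lemma distR_ge0 alpha x : alpha != fset0 -> 0 <= distR alpha x.
Proof. by move=> a0; apply: le_distR => // b _; exact: norm_ge0. Qed.

Lemma distR_lip alpha x y : alpha != fset0 ->
  distR alpha x <= N (x - y) + distR alpha y.
Proof.
move=> a0; have [a aa [_ -> _]] := distR_spec y a0.
by rewrite (le_trans (distR_le _ aa))// normN_tri.
Qed.

Lemma continuous_distR alpha : alpha != fset0 -> continuous (distR alpha).
Proof.
by move=> a0; apply: (continuous_lipN N_norm) => x y; exact: distR_lip.
Qed.

Lemma voronoiP a alpha x : a \in alpha ->
  voronoi N a alpha x <-> N (x - a) = distR alpha x.
Proof.
move=> aa; have a0 : alpha != fset0 by apply/fset0Pn; exists a.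
by rewrite /voronoi/= distRE//; split=> [[]|->].
Qed.

Lemma closed_voronoi a alpha : a \in alpha -> closed (voronoi N a alpha).
Proof.
move=> aa; have a0 : alpha != fset0 by apply/fset0Pn; exists a.
rewrite (_ : voronoi N a alpha =
    (fun x => N (x - a) - distR alpha x) @^-1` [set t | t = 0]); last first.
  apply/seteqP; split => x /=.
    by move/(voronoiP _ aa) => ->; rewrite subrr.
  by move/eqP; rewrite subr_eq0 => /eqP h; apply/voronoiP.
apply: (@closed_comp _ _ _ [set t | t = 0]) => [x _|]; last exact: closed_eq.
by apply: continuousB; [exact: continuous_ndist|exact: continuous_distR].
Qed.

Lemma measurable_voronoi a alpha : a \in alpha -> measurable (voronoi N a alpha).
Proof.
move=> aa; rewrite -[X in measurable X]setCK; apply: measurableC.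
by apply: measurable_rV_open; rewrite openC; exact: closed_voronoi.
Qed.

Lemma setD1_fsetD1 a alpha : [set` alpha] `\ a = [set` (alpha `\ a)%fset].
Proof.
apply/seteqP; split => x /=; rewrite !inE.
  by move=> [-> /eqP ->].
by move=> /andP[/eqP ? ->].
Qed.

Lemma open_voronoiP a alpha x : (alpha `\ a)%fset != fset0 ->
  open_voronoi N a alpha x <-> N (x - a) < distR (alpha `\ a)%fset x.
Proof. by move=> a0; rewrite /open_voronoi/= setD1_fsetD1 distRE. Qed.

Lemma measurable_open_voronoi a alpha : (alpha `\ a)%fset != fset0 ->
  measurable (open_voronoi N a alpha).
Proof.
move=> a0; apply: measurable_rV_open.
rewrite (_ : open_voronoi N a alpha =
    (fun x => N (x - a) - distR (alpha `\ a)%fset x) @^-1` [set t | t < 0]).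
  apply: open_comp; last exact: open_lt.
  by move=> x _; apply: continuousB;
    [exact: continuous_ndist|exact: continuous_distR].
apply/seteqP; split => x /=.
  by move/(open_voronoiP _ a0); rewrite subr_lt0.
by rewrite subr_lt0 => h; apply/open_voronoiP.
Qed.

(** Off the open cell of [a], removing [a] does not change the distance. *)
Lemma distR_fsetD1 a alpha x : (alpha `\ a)%fset != fset0 ->
  ~ open_voronoi N a alpha x -> distR (alpha `\ a)%fset x = distR alpha x.
Proof.
move=> a0 /(open_voronoiP _ a0)/negP; rewrite -leNgt => h.
apply/eqP; rewrite eq_le; apply/andP; split; last first.
  by apply: le_distR => // b; rewrite !inE => /andP[_ ba]; exact: distR_le.
have a1 : alpha != fset0.
  by have /fset0Pn[b] := a0; rewrite !inE => /andP[_ ?]; apply/fset0Pn; exists b.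
apply: le_distR => // b ba; have [->//|bna] := eqVneq b a.
by apply: distR_le; rewrite !inE bna.
Qed.

Lemma open_voronoi_sub a alpha : a \in alpha ->
  open_voronoi N a alpha `<=` voronoi N a alpha.
Proof.
move=> aa x h; apply/voronoiP => //; apply/eqP; rewrite eq_le distR_le// andbT.
apply: le_distR => [|b ba]; first by apply/fset0Pn; exists a.
have [->//|bna] := eqVneq b a.
rewrite -lee_fin (le_trans (ltW h))//; apply: ereal_inf_lbound.
by exists b => //; split => //= /eqP; exact/negP.
Qed.

(** Voronoi cells are star-shaped with respect to their centre, for every
    norm. *)
Lemma voronoi_star a alpha x t : a \in alpha -> 0 <= t <= 1 ->
  voronoi N a alpha x -> voronoi N a alpha (a + t *: (x - a)).
Proof.
move=> aa /andP[t0 t1] /(voronoiP _ aa) xa; apply/voronoiP => //.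
apply/eqP; rewrite eq_le distR_le// andbT.
apply: le_distR => [|b ba]; first by apply/fset0Pn; exists a.
set y := a + _; have ya : N (y - a) = t * N (x - a).
  by rewrite /y addrAC subrr add0r (norm_scale N_norm) ger0_norm.
have xy : N (x - y) = (1 - t) * N (x - a).
  rewrite (_ : x - y = (1 - t) *: (x - a)); last first.
    by rewrite scalerBl scale1r /y opprD addrA.
  by rewrite (norm_scale N_norm) ger0_norm// subr_ge0.
have := normN_tri N_norm y x b; rewrite xy ya.
have := distR_le x ba; rewrite -xa; lra.
Qed.

End distance.

(** * Comparison of the probability and of Lebesgue measure *)

Section measure_comparison.
Context (R : realType) (d : nat).
Local Notation lam := (lebesgue_rV R d).

Lemma measurable_continuous_rV (f : 'rV[R]_d -> R) : continuous f ->
  measurable_fun setT (f : 'rV[R]_d -> measurableTypeR R).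
Proof.
move=> cf; apply: (measurability _ (RGenOpens.measurableE R)) => _ [_ [a [b ->]] <-].
rewrite setTI; apply: measurable_rV_open.
by apply: open_comp; last exact: interval_open; move=> x _; exact: cf.
Qed.

Context (P : probability 'rV[R]_d R) (h : 'rV[R]_d -> R) (Ph : is_density P h).

Lemma probability_le_lebesgue A (t : R) : measurable A -> 0 <= t ->
  {ae lam, forall x, A x -> h x <= t} -> (P A <= t%:E * lam A)%E.
Proof.
move=> mA t0 ht; rewrite (densityE Ph)// -integral_cst//.
apply: ae_ge0_le_integral => //.
- by move=> x _; rewrite lee_fin (density_ge0 Ph).
- by apply/measurable_EFinP; apply: measurable_funS (density_measurable Ph).
Qed.

Lemma lebesgue_le_probability A (t : R) : measurable A -> 0 <= t ->
  (forall x, A x -> t <= h x) -> (t%:E * lam A <= P A)%E.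
Proof.
move=> mA t0 ht; rewrite (densityE Ph)// -integral_cst//.
apply: ge0_le_integral => //.
- by apply/measurable_EFinP; apply: measurable_funS (density_measurable Ph).
Qed.

Lemma integral_le_probability A (f : 'rV[R]_d -> R) (t : R) : measurable A ->
  measurable_fun setT (f : 'rV[R]_d -> measurableTypeR R) ->
  (forall x, A x -> 0 <= f x <= t) -> 0 <= t ->
  (\int[P]_(x in A) (f x)%:E <= t%:E * P A)%E.
Proof.
move=> mA mf ft t0; rewrite -integral_cst//.
apply: ge0_le_integral => //.
- by move=> x /ft/andP[? _]; rewrite lee_fin.
- by apply/measurable_EFinP; apply: measurable_funS mf.
by move=> x /ft/andP[_ ?]; rewrite lee_fin.
Qed.

Lemma probability_le_integral A (f : 'rV[R]_d -> R) (t : R) : measurable A ->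
  measurable_fun setT (f : 'rV[R]_d -> measurableTypeR R) ->
  (forall x, A x -> t <= f x) -> 0 <= t ->
  (t%:E * P A <= \int[P]_(x in A) (f x)%:E)%E.
Proof.
move=> mA mf ft t0; rewrite -integral_cst//.
apply: ge0_le_integral => //.
- by apply/measurable_EFinP; apply: measurable_funS mf.
Qed.

End measure_comparison.

(** * Distortion of optimal codebooks *)

Section distortion.
Context (R : realType) (d : nat) (d_ge1 : (1 <= d)%N).
Context (N : 'rV[R]_d -> R) (N_norm : is_norm N) (r : R) (r_gt0 : 0 < r).
Context (P : probability 'rV[R]_d R).
Implicit Types (x y a b : 'rV[R]_d) (alpha : {fset 'rV[R]_d}).
Local Notation lam := (lebesgue_rV R d).

Lemma measurable_distR_powR alpha : alpha != fset0 ->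
  measurable_fun setT (fun x => distR N alpha x `^ r : measurableTypeR R).
Proof.
move=> a0; apply: (measurableT_comp (measurable_powR r)).
by apply: measurable_continuous_rV; exact: continuous_distR.
Qed.

Lemma distortionE alpha : alpha != fset0 ->
  distortion N r P alpha = (\int[P]_x (distR N alpha x `^ r)%:E)%E.
Proof.
by move=> a0; apply: eq_integral => x _; rewrite distRE.
Qed.

Lemma distortion_fset0 : distortion N r P fset0 = +oo%E.
Proof.
rewrite /distortion (_ : (fun x => _) = cst +oo%E); last first.
  apply/funext => x; rewrite /dist (_ : [set _ | a in _] = set0).
    by rewrite ereal_inf0 poweRyr// gt_eqF.
  by apply/seteqP; split => // y [a]; rewrite /= inE.
by rewrite integral_cst// [X in (_ * X)%E]probability_setT mule1.
Qed.

Lemma measurable_add_indic (f : 'rV[R]_d -> R) (c : R) (A : set 'rV[R]_d) :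
  measurable A -> measurable_fun setT (f : 'rV[R]_d -> measurableTypeR R) ->
  measurable_fun setT (fun x => f x + c * \1_A x : measurableTypeR R).
Proof.
move=> mA mf; apply: (@measurable_funD _ _ _ _ f (fun x => c * \1_A x)) => //.
apply: (@measurable_funM _ _ _ _ (cst c) (\1_A)).
  exact: measurable_cst.
exact: measurable_indic.
Qed.

Lemma integral_add_indic (f : 'rV[R]_d -> R) (c : R) A : 0 <= c ->
  measurable A -> measurable_fun setT (f : 'rV[R]_d -> measurableTypeR R) ->
  (forall x, 0 <= f x) ->
  (\int[P]_x (f x + c * \1_A x)%:E = \int[P]_x (f x)%:E + c%:E * P A)%E.
Proof.
move=> c0 mA mf f0.
have mi : measurable_fun setT (fun x => (\1_A x : R)%:E).
  by apply/measurable_EFinP; exact: measurable_indic.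
under eq_integral do rewrite EFinD EFinM.
rewrite ge0_integralD//; last 4 first.
- by move=> x _; rewrite lee_fin.
- exact/measurable_EFinP.
- by move=> x _; rewrite mule_ge0 ?lee_fin.
- exact: measurable_funeM.
rewrite ge0_integralZl_EFin//.
by rewrite integral_indic// setIT.
Qed.

Lemma distortion_fset1_lty : (exists2 delta : R, 0 < delta &
    (\int[P]_x (N x `^ (r + delta))%:E < +oo)%E) ->
  (distortion N r P [fset (0 : 'rV[R]_d)%R]%fset < +oo)%E.
Proof.
move=> [delta delta0 mom].
have n0 : [fset (0 : 'rV[R]_d)]%fset != fset0 by apply/fset0Pn; exists 0; rewrite inE.
have mN p : measurable_fun setT (fun x => N x `^ p : measurableTypeR R).
  apply: (measurableT_comp (measurable_powR p)).
  by apply: measurable_continuous_rV; exact: continuous_normN.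
rewrite (distortionE n0).
apply: (@le_lt_trans _ _ (\int[P]_x (N x `^ (r + delta) + 1 * \1_[set: 'rV[R]_d] x)%:E)%E).
  apply: ge0_le_integral => //.
  - by move=> x _; rewrite lee_fin powR_ge0.
  - by apply/measurable_EFinP; exact: measurable_distR_powR.
  - apply/measurable_EFinP; apply: measurable_add_indic => //.

  move=> x _; rewrite lee_fin indicT mul1r.
  have [a] := distR_spec N x n0; rewrite inE => /eqP -> [_ -> _]; rewrite subr0.
  have Nx := norm_ge0 N_norm x.
  have [N1|N1] := leP (N x) 1.
    by rewrite ler_wpDl ?powR_ge0// powR_le1 ?Nx// ltW.
  rewrite ler_wpDr// ler_powR ?ltW//.
  by rewrite ltrDl.
rewrite integral_add_indic//; last by move=> x; exact: powR_ge0.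
by rewrite lte_add_pinfty// mul1e (le_lt_trans (probability_le1 P _))// ltry.
Qed.

(** Moments make the distortion finite, so an optimal codebook is nonempty. *)
Lemma optimal_codebook_finite n alpha : (1 <= n)%N ->
  (distortion N r P [fset (0 : 'rV[R]_d)%R]%fset < +oo)%E ->
  is_optimal_codebook N r P n alpha ->
  alpha != fset0 /\ distortion N r P alpha \is a fin_num.
Proof.
move=> n1 fin [_ opt].
have lty : (distortion N r P alpha < +oo)%E.
  rewrite opt (le_lt_trans _ fin)//; apply: ereal_inf_lbound.
  by exists [fset (0 : 'rV[R]_d)%R]%fset => //=; rewrite cardfs1.
split; last first.
  rewrite ge0_fin_numE//; apply: integral_ge0 => x _; exact: poweR_ge0.
by apply/eqP => a0; move: lty; rewrite a0 distortion_fset0.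
Qed.

Lemma optimal_codebook_le n alpha beta : is_optimal_codebook N r P n alpha ->
  (1 <= #|` beta| <= n)%N -> (distortion N r P alpha <= distortion N r P beta)%E.
Proof. by move=> [_ ->] b; apply: ereal_inf_lbound; exists beta. Qed.

Context (h : 'rV[R]_d -> R) (Ph : is_density P h).
Context (h_lower : forall rho : R, 0 < rho ->
      exists2 c : R, 0 < c & forall x, N x <= rho -> c <= h x).

Lemma lebesgue_bigcup_ballN (k s : R) (t : seq 'rV[R]_d) :
  (forall a, (lam (ballN N a s) <= k%:E)%E) ->
  (lam (\big[setU/set0]_(a <- t) ballN N a s) <= ((size t)%:R * k)%:E)%E.
Proof.
move=> lk; have mb a := measurable_ballN N_norm a s.
elim: t => [|a t IH]; first by rewrite big_nil measure0 mul0r.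
rewrite big_cons (le_trans (measureU2 _ (mb a) _))//.
  by elim/big_ind: _ => // A B; exact: measurableU.
by rewrite /= -natr1 mulrDl mul1r addrC EFinD leeD.
Qed.

(** [n] balls of radius of order [n^(-1/d)] cannot cover the unit ball, so some
    point [y] of it stays at that distance from the codebook; adding [y] lowers
    the distortion by at least the order of [n^(-(1+r/d))], because [h] is bounded
    below near the unit ball. *)
Lemma distortion_gain : exists2 c : R, 0 < c & forall n alpha, (1 <= n)%N ->
  alpha != fset0 -> (#|` alpha| <= n)%N -> exists y,
  (distortion N r P (y |` alpha)%fset + (c * n%:R `^ (- (1 + r / d%:R)))%:E <=
   distortion N r P alpha)%E.
Proof.
have [c2 c20 hc2] := h_lower (ltr0Sn R 1).
have [[k1 k2] /= [k10 k20 lamb]] := lebesgue_ballN N_norm.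
pose q := k1 / (2 * k2).
have q0 : 0 < q by rewrite divr_gt0// mulr_gt0.
have k12 : k1 <= k2.
  have /andP[l1 l2] := lamb 0 1 ler01.
  by have := le_trans l1 l2; rewrite expr1n !mulr1 lee_fin.
have d0 : (0 : R) < d%:R by rewrite ltr0n.
pose cr : R := (3 / 4) `^ r - (1 / 4) `^ r.
have cr0 : 0 < cr by rewrite subr_gt0 gt0_ltr_powR// ?nnegrE; lra.
exists (cr * (c2 * (k1 * (4^-1) ^+ d)) * q `^ (1 + r / d%:R)).
  by rewrite !mulr_gt0 ?exprn_gt0 ?invr_gt0 ?powR_gt0.
move=> n alpha n1 a0 an.
have n0 : (0 : R) < n%:R by rewrite ltr0n.
have n1' : (1 : R) <= n%:R by rewrite ler1n.
pose s := (q / n%:R) `^ (d%:R^-1).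
have qn0 : 0 < q / n%:R by rewrite divr_gt0.
have s0 : 0 < s by rewrite powR_gt0.
have sd : s ^+ d = q / n%:R.
  by rewrite -powR_mulrn ?ltW// /s -powRrM mulVf ?gt_eqF// powRr1// ltW.
have s1 : s <= 1.
  rewrite /s powR_le1 ?invr_ge0 ?ler0n// (ltW qn0)/=.
  have : q <= 1 by rewrite ler_pdivrMr ?mulr_gt0//; lra.
  by move=> q1; rewrite (ler_pdivrMr _ _ n0) mul1r (le_trans q1).
(* the covering would give k1 <= n k2 s^d = k1 / 2 *)
have [y [y1 ys]] : exists y, N y <= 1 /\ s < distR N alpha y.
  apply: contrapT => hn.
  have cov : ballN N 0 1 `<=` \big[setU/set0]_(a <- alpha) ballN N a s.
    move=> y; rewrite /ballN/= subr0 => y1.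
    have [sl|ls] := ltP s (distR N alpha y); first by case: hn; exists y.
    have [a aa [_ ya _]] := distR_spec N y a0.
    rewrite -bigcup_seq; exists a => //=.
    by rewrite -ya.
  have mb a t := measurable_ballN N_norm a t.
  have mU : measurable (\big[setU/set0]_(a <- alpha) ballN N a s).
    by elim/big_ind: _ => // A B; exact: measurableU.
  have l1 := @le_measure _ _ _ lam _ _ (mem_set (mb 0 1)) (mem_set mU) cov.
  have l2 : (lam (\big[setU/set0]_(a <- alpha) ballN N a s) <=
      ((size alpha)%:R * (k2 * s ^+ d))%:E)%E.
    apply: lebesgue_bigcup_ballN => a.
    by have /andP[_] := lamb a s (ltW s0).
  have /andP[l0 _] := lamb 0 1 ler01.
  have := le_trans l0 (le_trans l1 l2); rewrite lee_fin expr1n mulr1 sd.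
  apply/negP; rewrite -ltNge.
  have e : k2 * (q / n%:R) = k1 / 2 / n%:R.
    by rewrite /q; field; rewrite ?gt_eqF.
  rewrite e (@le_lt_trans _ _ (n%:R * (k1 / 2 / n%:R)))//.
    by rewrite ler_wpM2r ?ler_nat// !divr_ge0// ltW.
  by rewrite mulrCA divff ?gt_eqF// mulr1; lra.
exists y.
pose B := ballN N y (s / 4).
have mB : measurable B := measurable_ballN N_norm y (s / 4).
have ya0 : (y |` alpha)%fset != fset0 by apply/fset0Pn; exists y; rewrite !inE eqxx.
have PB : ((c2 * (k1 * (s / 4) ^+ d))%:E <= P B)%E.
  have s4 : 0 <= s / 4 by rewrite divr_ge0// ltW.
  have /andP[lb _] := lamb y _ s4.
  rewrite EFinM (@le_trans _ _ (c2%:E * lam B)%E)//.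
    by rewrite lee_pmul2l// lte_fin.
  apply: (lebesgue_le_probability Ph mB (ltW c20)) => x; rewrite /B/ballN/= => xy.
  apply: hc2; rewrite -[x](subrK y) (le_trans (norm_triangle N_norm _ _))//; lra.
have p1 : (distortion N r P (y |` alpha)%fset + (cr * s `^ r)%:E * P B <=
    distortion N r P alpha)%E.
  have crs : 0 <= cr * s `^ r by rewrite mulr_ge0 ?powR_ge0 ?ltW.
  rewrite !distortionE// -integral_add_indic//; last 2 first.
  - exact: measurable_distR_powR.
  - by move=> x; exact: powR_ge0.
  apply: ge0_le_integral => //.
  - by move=> x _; rewrite lee_fin addr_ge0 ?powR_ge0// mulr_ge0// indicE.
  - apply/measurable_EFinP; apply: measurable_add_indic => //.
    exact: measurable_distR_powR.
  - by apply/measurable_EFinP; exact: measurable_distR_powR.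
  move=> x _; rewrite lee_fin indicE; case: (boolP (x \in B)) => [|_]; last first.
    rewrite mulr0 addr0 ge0_ler_powR ?nnegrE ?(distR_ge0 N_norm) ?(ltW r_gt0)//.
    by apply: le_distR => // b ba; apply: distR_le; rewrite !inE ba orbT.
  rewrite inE /B /ballN /= mulr1 => xB.
  have u1 : distR N (y |` alpha)%fset x <= s / 4.
    by rewrite (le_trans _ xB)// distR_le// !inE eqxx.
  have u2 : 3 / 4 * s <= distR N alpha x.
    by have := distR_lip N_norm y x a0; rewrite (normNC N_norm); lra.
  apply: (@le_trans _ _ ((1 / 4 * s) `^ r + cr * s `^ r)).
    rewrite lerD2r ge0_ler_powR ?nnegrE ?(distR_ge0 N_norm) ?(ltW r_gt0)//; lra.
  have -> : (1 / 4 * s) `^ r + cr * s `^ r = (3 / 4 * s) `^ r.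
    rewrite (@powRM _ (1 / 4)) ?(@powRM _ (3 / 4)) ?(ltW s0) ?divr_ge0//.
    rewrite -mulrDl; congr (_ * _).
    by rewrite /cr addrC subrK.
  rewrite ge0_ler_powR ?nnegrE ?(distR_ge0 N_norm) ?(ltW r_gt0)//.
  by rewrite mulr_ge0 ?(ltW s0)//; lra.
apply: le_trans p1; rewrite leeD2l//.
apply: (@le_trans _ _ ((cr * s `^ r)%:E * (c2 * (k1 * (s / 4) ^+ d))%:E)%E).
  rewrite -EFinM lee_fin le_eqVlt; apply/orP; left; apply/eqP.
  have sr : s `^ r * s ^+ d = q `^ (1 + r / d%:R) * n%:R `^ (- (1 + r / d%:R)).
    transitivity ((q / n%:R) `^ (1 + r / d%:R)).
      have qnN0 : q / n%:R != 0 by rewrite gt_eqF.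
      rewrite powRD ?qnN0 ?implybT// powRr1 ?(ltW qn0)//.
      by rewrite sd mulrC /s -powRrM [_ * r]mulrC.
    rewrite powRM ?invr_ge0 ?(ltW q0) ?ler0n//.
    by rewrite -(powR_inv1 (ler0n R n)) -powRrM mulN1r.
  rewrite expr_div_n exprVn -mulrA -sr; ring.
by rewrite lee_pmul2l// lte_fin mulr_gt0// powR_gt0.
Qed.

(** Removing [a] from an optimal codebook of size [n] costs at least the gain of
    [distortion_gain] at level [n - 1], and at most [D^r] times the mass of the
    open cell of [a]. *)
Lemma open_voronoi_mass (alpha : nat -> {fset 'rV[R]_d})
    (alpha_opt : forall n, (1 <= n)%N -> is_optimal_codebook N r P n (alpha n))
    (fin : (distortion N r P [fset (0 : 'rV[R]_d)%R]%fset < +oo)%E) :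
  exists2 c : R, 0 < c & forall n (D : R) a, (2 <= n)%N -> a \in alpha n ->
  (alpha n `\ a)%fset != fset0 -> 0 <= D ->
  (forall x, open_voronoi N a (alpha n) x -> distR N (alpha n `\ a)%fset x <= D) ->
  ((c * n%:R `^ (- (1 + r / d%:R)))%:E <=
   (D `^ r)%:E * P (open_voronoi N a (alpha n)))%E.
Proof.
have [c c0 gain] := distortion_gain.
exists c => // -[|n] // D a n1 aa a0 D0 aD.
have opt := alpha_opt n.+1 isT.
have n1' : (1 <= n)%N by [].
have opt' := alpha_opt n n1'.
have [al0 alfin] := optimal_codebook_finite (isT : (1 <= n.+1)%N) fin opt.
have [al0' alfin'] := optimal_codebook_finite n1' fin opt'.
have [y gy] := gain n (alpha n) n1' al0' (proj1 opt').
have card_y : (1 <= #|` (y |` alpha n)%fset| <= n.+1)%N.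
  rewrite cardfsU1; apply/andP; split.
    by rewrite addn_gt0 cardfs_gt0 al0' orbT.
  exact: (leq_add (leq_b1 _) (proj1 opt')).
have card_a : (1 <= #|` (alpha n.+1 `\ a)%fset| <= n)%N.
  rewrite cardfs_gt0 a0/=.
  by have := proj1 opt; rewrite (cardfsD1 a) aa add1n ltnS.
have mW := measurable_open_voronoi N_norm a0.
have up : (distortion N r P (alpha n.+1 `\ a)%fset <=
    distortion N r P (alpha n.+1) +
    (D `^ r)%:E * P (open_voronoi N a (alpha n.+1)))%E.
  rewrite !distortionE// -integral_add_indic ?powR_ge0//; last 2 first.
  - exact: measurable_distR_powR.
  - by move=> x; exact: powR_ge0.
  apply: ge0_le_integral => //.
  - by move=> x _; rewrite lee_fin powR_ge0.
  - by apply/measurable_EFinP; exact: measurable_distR_powR.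
  - apply/measurable_EFinP; apply: measurable_add_indic => //.
    exact: measurable_distR_powR.
  move=> x _; rewrite lee_fin indicE.
  case: (boolP (x \in _)) => [|]; last first.
    rewrite notin_setE => xW.
    by rewrite mulr0 addr0 distR_fsetD1.
  rewrite inE mulr1 => xW; rewrite ler_wpDl ?powR_ge0//.
  by rewrite ge0_ler_powR ?nnegrE ?(distR_ge0 N_norm) ?(ltW r_gt0)// aD.
have := optimal_codebook_le opt card_y.
have := optimal_codebook_le opt' card_a.
move=> le1 le2.
have : (distortion N r P (alpha n.+1) + (c * n%:R `^ (- (1 + r / d%:R)))%:E <=
   distortion N r P (alpha n.+1) +
   (D `^ r)%:E * P (open_voronoi N a (alpha n.+1)))%E.
  apply: le_trans up; apply: le_trans le1; apply: le_trans gy.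
  by rewrite leeD2r.
rewrite leeD2lE//; apply: le_trans; rewrite lee_fin ler_pM2l//.
rewrite !powRN lef_pV2 ?posrE ?powR_gt0 ?ltr0n//.
have ex0 : 0 <= 1 + r / d%:R by rewrite addr_ge0// divr_ge0 ?ler0n ?(ltW r_gt0).
by apply: ge0_ler_powR; rewrite ?nnegrE ?ler0n ?ler_nat.
Qed.

End distortion.

(** * Geometry of the cells meeting a compact set *)

Section geometry.
Context (R : realType) (d : nat) (d_ge1 : (1 <= d)%N).
Context (N : 'rV[R]_d -> R) (N_norm : is_norm N).
Implicit Types (x y z a b : 'rV[R]_d) (K : set 'rV[R]_d).
Local Notation lam := (lebesgue_rV R d).

Lemma closed_nbhdI K (e : R) y z : K z -> N (y - z) <= e -> closed_nbhd N K e y.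
Proof.
move=> Kz yz; rewrite /closed_nbhd/= (@le_trans _ _ (N (y - z))%:E)//.
by apply: ereal_inf_lbound; exists z.
Qed.

Lemma closed_nbhd_bounded K (e : R) : compact K ->
  exists2 rho : R, 0 < rho & forall y, closed_nbhd N K e y -> N y <= rho.
Proof.
move=> /compact_bounded[M [_ KM]]; have [C C0 NC] := normN_le_sup N_norm.
have KM1 z : K z -> `|z| <= `|M| + 1.
  by move=> Kz; apply: (KM (`|M| + 1)) => //; rewrite (le_lt_trans (ler_norm _))// ltrDl.
exists (`|e| + 1 + C * (`|M| + 1)).
  by rewrite addr_gt0// ?mulr_gt0// ?ltr_wpDl.
move=> y yK; have /ereal_inf_lt[_ [z Kz <-]] : (dist N y K < (e + 1)%:E)%E.
  by rewrite (le_lt_trans yK)// lte_fin ltrDl.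
rewrite lte_fin => yz; rewrite -(subrK z y) (le_trans (norm_triangle N_norm _ _))//.
rewrite lerD// ?(le_trans (ltW yz)) ?lerD2r ?ler_norm//.
by rewrite (le_trans (NC _))// ler_pM2l// KM1.
Qed.

Lemma powR_inv_small (t : R) : 0 < t ->
  exists n0 : nat, forall n, (n0 <= n)%N -> n%:R `^ (- (1 / d%:R)) <= t.
Proof.
move=> t0; have d0 : (0 : R) < d%:R by rewrite ltr0n.
exists (Num.truncn ((t^-1) ^+ d)).+1 => n hn.
have tn : (t^-1) ^+ d <= n%:R.
  by rewrite (le_trans (ltW (truncnS_gt _)))// ler_nat.
have n0 : (0 : R) < n%:R by rewrite ltr0n (leq_trans _ hn).
rewrite powRN -[leRHS]invrK lef_pV2 ?posrE ?invr_gt0 ?powR_gt0//.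
have -> : t^-1 = ((t^-1) ^+ d) `^ (1 / d%:R).
  rewrite -powR_mulrn ?invr_ge0 ?ltW// -powRrM mulrC div1r mulVf ?gt_eqF//.
  by rewrite powRr1// invr_ge0 ltW.
by apply: ge0_ler_powR; rewrite ?nnegrE ?divr_ge0 ?exprn_ge0 ?invr_ge0// ltW.
Qed.

Lemma ae_ballN_ex (Q : 'rV[R]_d -> Prop) y (s : R) : 0 < s ->
  {ae lam, forall x, Q x} -> exists2 x, N (x - y) <= s & Q x.
Proof.
move=> s0 [Z [mZ Z0 QZ]]; apply: contrapT => hn.
have [[k1 k2] /= [k10 _ lamb]] := lebesgue_ballN N_norm.
have /andP[lb _] := lamb y s (ltW s0).
have : (lam (ballN N y s) <= lam Z)%E.
  apply: le_measure; rewrite ?inE//; first exact: measurable_ballN.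
  move=> x xy; apply: QZ => Qx; apply: hn; exists x => //.
rewrite Z0 => /(le_trans lb); rewrite lee_fin; apply/negP.
by rewrite -ltNge mulr_gt0// exprn_gt0.
Qed.

Lemma norm_eq_ex a (s : R) : 0 <= s -> exists y, N (y - a) = s.
Proof.
move=> s0; pose v : 'rV[R]_d := const_mx 1.
have v0 : N v != 0.
  apply/eqP => /(norm_eq0 N_norm)/rowP/(_ (Ordinal d_ge1)).
  by rewrite !mxE => /eqP; rewrite oner_eq0.
exists (a + (s / N v) *: v); rewrite addrAC subrr add0r (norm_scale N_norm).
by rewrite ger0_norm ?divr_ge0 ?norm_ge0// divfK.
Qed.

Context (r : R) (r_gt0 : 0 < r) (h : 'rV[R]_d -> R).
Context (alpha : nat -> {fset 'rV[R]_d}).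
Context (alpha_neq0 : forall n, (1 <= n)%N -> alpha n != fset0).
Context (c : R) (c_gt0 : 0 < c).
Context (micro : forall K, compact K -> exists nK : nat,
  forall n : nat, (nK <= n)%N -> forall x, K x ->
  (dist N x [set` alpha n] <=
   (c * n%:R `^ (- (1 / d%:R)) * h x `^ (- (1 / (r + d%:R))))%:E)%E).

Lemma micro_nbhd K (e : R) : compact K -> exists nK : nat,
  forall n, (nK <= n)%N -> forall x, closed_nbhd N K e x ->
  distR N (alpha n) x <=
  c * n%:R `^ (- (1 / d%:R)) * h x `^ (- (1 / (r + d%:R))).
Proof.
move=> cK; have [rho rho0 Krho] := closed_nbhd_bounded e cK.
have [nK nKP] := micro (@compact_ballN _ _ _ N_norm 0 rho).
exists (maxn 1 nK) => n; rewrite geq_max => /andP[n1 nn] x Kx.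
have := nKP n nn x; rewrite distRE ?alpha_neq0// lee_fin; apply.
by rewrite /ballN/= subr0 Krho.
Qed.

(** If [h >= m] almost everywhere near [K], then for large [n] the cells meeting
    [K] have radius at most [3 D] and stay near [K], and their centre has
    another codebook point within [5 D], where
    [D = c n^(-1/d) m^(-1/(r+d))] is the value of the micro-macro bound. *)
Lemma cell_geometry K (e m : R) : compact K -> 0 < e -> 0 < m ->
  {ae lam, forall x, closed_nbhd N K e x -> m <= h x} ->
  exists n0 : nat, forall n, (n0 <= n)%N ->
  forall a, a \in codebook_on N (alpha n) K ->
  let D := c * n%:R `^ (- (1 / d%:R)) * m `^ (- (1 / (r + d%:R))) in
  [/\ voronoi N a (alpha n) `<=` ballN N a (3 * D),
      ballN N a (4 * D) `<=` closed_nbhd N K e,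
      exists b, [/\ b \in alpha n, b != a & N (a - b) <= 5 * D] &
      forall x, closed_nbhd N K e x -> distR N (alpha n) x <=
        c * n%:R `^ (- (1 / d%:R)) * h x `^ (- (1 / (r + d%:R)))].
Proof.
move=> cK e0 m0 hm.
have d0 : (0 : R) < d%:R by rewrite ltr0n.
have rd0 : 0 < r + d%:R by rewrite addr_gt0.
have [n1 mic] := micro_nbhd e cK.
have mp0 : 0 < m `^ (- (1 / (r + d%:R))) by rewrite powR_gt0.
have t0 : 0 < e / (8 * (c * m `^ (- (1 / (r + d%:R))))).
  by rewrite divr_gt0// !mulr_gt0.
have [n2 small] := powR_inv_small t0.
exists (maxn 1 (maxn n1 n2)) => n; rewrite !geq_max => /and3P[n0 n1n n2n] a.
rewrite !inE => /andP[aa /asboolP[z [Wz Kz]]] D.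
have {}aa : a \in alpha n := aa.
have D0 : 0 < D by rewrite !mulr_gt0// powR_gt0// ltr0n.
have De : 8 * D <= e.
  have := small n n2n; rewrite ler_pdivlMr; last by rewrite !mulr_gt0.
  by rewrite /D; congr (_ <= _); ring.
have al0 := alpha_neq0 n0.
have near2D y : N (y - z) <= e - D -> distR N (alpha n) y <= 2 * D.
  move=> yz; have [y' y'y hy'] := ae_ballN_ex y D0 hm.
  have Ky' : closed_nbhd N K e y'.
    apply: (closed_nbhdI Kz).
    by have := normN_tri N_norm y y' z; lra.
  have := mic n n1n y' Ky'; have := hy' Ky' => mh hy.
  have : h y' `^ (- (1 / (r + d%:R))) <= m `^ (- (1 / (r + d%:R))).
    have h0 := lt_le_trans m0 mh.
    rewrite !powRN lef_pV2 ?posrE ?powR_gt0//.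
    by apply: ge0_ler_powR; rewrite ?nnegrE ?divr_ge0// ltW.
  rewrite -(ler_pM2l (_ : 0 < c * n%:R `^ (- (1 / d%:R)))); last first.
    by rewrite mulr_gt0// powR_gt0// ltr0n.
  rewrite -/D => hD; have := distR_lip N_norm y y' al0.
  by rewrite (normNC N_norm); lra.
have za : N (z - a) <= 2 * D.
  move/(voronoiP N _ aa) : Wz => ->; apply: near2D.
  by rewrite subrr (normN0 N_norm); lra.
have near_a y : N (y - a) <= 3 * D -> distR N (alpha n) y <= 2 * D.
  move=> ya; apply: near2D; have := normN_tri N_norm a y z.
  by rewrite (normNC N_norm a z); lra.
split.
- move=> x Wx; rewrite /ballN/= leNgt; apply/negP => xa.
  have xa0 : 0 < N (x - a) by rewrite (le_lt_trans _ xa)// mulr_ge0// ltW.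
  pose t := 3 * D / N (x - a).
  have t01 : 0 <= t <= 1.
    rewrite /t divr_ge0 ?ler_pdivrMr ?mul1r ?(ltW xa)// ?(ltW xa0)//.
    by rewrite mulr_ge0// ltW.
  have := voronoi_star N_norm aa t01 Wx.
  set y := a + _; have ya : N (y - a) = 3 * D.
    rewrite /y addrAC subrr add0r (norm_scale N_norm) ger0_norm.
      by rewrite /t divfK// gt_eqF.
    by have /andP[] := t01.
  move/(voronoiP N _ aa); rewrite ya => yd.
  by have := near_a y; rewrite ya -yd => /(_ (lexx _)); lra.
- move=> y; rewrite /ballN/= => ya; apply: (closed_nbhdI Kz).
  by have := normN_tri N_norm a y z; rewrite (normNC N_norm a z); lra.
- have [y ya] : exists y, N (y - a) = 3 * D.
    by apply: norm_eq_ex; rewrite mulr_ge0// ltW.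
  have := near_a y; rewrite ya => /(_ (lexx _)) yd.
  have [b ba [_ yb _]] := distR_spec N y al0.
  exists b; split => //.
    by apply/eqP => bea; move: yb yd; rewrite bea ya => ->; lra.
  have := normN_tri N_norm y a b; rewrite (normNC N_norm a y) ya -yb; lra.
by move=> x; exact: mic.
Qed.

End geometry.

(** * Mass and inertia of a cell by dyadic shells *)

Section shells.
Context (R : realType) (d : nat).
Context (N : 'rV[R]_d -> R) (N_norm : is_norm N) (r : R) (r_gt0 : 0 < r).
Context (P : probability 'rV[R]_d R) (h : 'rV[R]_d -> R) (Ph : is_density P h).
Local Notation lam := (lebesgue_rV R d).
Local Notation p := (r + d%:R).
Context (k2 : R) (k2_gt0 : 0 < k2).
Context (lamb : forall a s, 0 <= s -> (lam (ballN N a s) <= (k2 * s ^+ d)%:E)%E).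

Lemma probability_ballN_le (A : set 'rV[R]_d) a (s t : R) : measurable A ->
  0 <= s -> 0 <= t -> A `<=` ballN N a s ->
  {ae lam, forall x, A x -> h x <= t} -> (P A <= (t * (k2 * s ^+ d))%:E)%E.
Proof.
move=> mA s0 t0 As ht; rewrite (le_trans (probability_le_lebesgue Ph mA t0 ht))//.
rewrite EFinM lee_wpmul2l ?lee_fin// (le_trans _ (lamb a s0))//.
by apply: le_measure; rewrite ?inE//; exact: measurable_ballN.
Qed.

(** A point of a cell lying at distance more than [s] from the centre has small
    density; this is the micro-macro bound solved for [h]. *)
Lemma density_le_of_dist (u s t y : R) : 0 <= y -> 0 < u -> 0 < s -> s < t ->
  t <= u * y `^ (- (1 / p)) -> y <= (u / s) `^ p.
Proof.
move=> y0 u0 s0 st tu; have p0 : 0 < p by rewrite ltr_wpDr.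
have [->|yn0] := eqVneq y 0; first exact: powR_ge0.
have {yn0}y0' : 0 < y by rewrite lt_neqAle eq_sym yn0.
have yq0 : 0 < y `^ (1 / p) by rewrite powR_gt0.
have yus : y `^ (1 / p) <= u / s.
  have := lt_le_trans st tu; rewrite powRN ltr_pdivlMr// => h1.
  by rewrite ler_pdivlMr// mulrC ltW.
have -> : y = (y `^ (1 / p)) `^ p.
  by rewrite -powRrM div1r mulVf ?gt_eqF// powRr1.
by apply: ge0_ler_powR; rewrite ?nnegrE ?divr_ge0// ltW.
Qed.

(* [W] stands for the cell of [a], or any part of it *)
Context (a : 'rV[R]_d) (W : set 'rV[R]_d) (mW : measurable W).
Context (u H : R) (u_gt0 : 0 < u) (H_gt0 : 0 < H).
Context (W_micro : forall x, W x -> N (x - a) <= u * h x `^ (- (1 / p))).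
Context (W_le : {ae lam, forall x, W x -> h x <= H}).

(* at the distance [rho] from [a] the two bounds on the density agree *)
Let rho := u * H `^ (- (1 / p)).
Let q := (2^-1 : R) `^ r.

Let rho_gt0 : 0 < rho. Proof. by rewrite mulr_gt0// powR_gt0. Qed.
Let p_gt0 : 0 < p. Proof. by rewrite ltr_wpDr. Qed.

Let q_lt1 : q < 1. Proof. exact: powR_half_lt1. Qed.
Let q_gt0 : 0 < q. Proof. by rewrite powR_gt0// invr_gt0. Qed.

Let shell k := W `&` (ballN N a (2 ^+ k.+1 * rho) `\` ballN N a (2 ^+ k * rho)).

Let measurable_shell k : measurable (shell k).
Proof.
by apply: measurableI => //; apply: measurableD; exact: measurable_ballN.
Qed.

Let radius_gt0 k : 0 < 2 ^+ k * rho. Proof. by rewrite mulr_gt0// exprn_gt0. Qed.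

Lemma shell_mass k : (P (shell k) <= (k2 * 2 ^+ d * (H * rho ^+ d) * q ^+ k)%:E)%E.
Proof.
pose t := H * ((2^-1) ^+ k) `^ p.
have i0 : 0 <= (2^-1 : R) ^+ k by rewrite exprn_ge0// invr_ge0.
have -> : k2 * 2 ^+ d * (H * rho ^+ d) * q ^+ k =
    t * (k2 * (2 ^+ k.+1 * rho) ^+ d).
  rewrite /t powRD; last by rewrite expf_eq0 invr_eq0 pnatr_eq0 andbF implybT.
  rewrite powRX ?invr_ge0// -/q powR_mulrn//.
  have e : (2^-1 : R) ^+ k * (2 ^+ k.+1 * rho) = 2 * rho.
    by rewrite exprS exprVn; field; rewrite expf_neq0// pnatr_eq0.
  transitivity (k2 * H * q ^+ k * (2 * rho) ^+ d); first by rewrite (exprMn _ 2 rho); ring.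
  by rewrite -e (exprMn _ (2^-1 ^+ k)); ring.
apply: (@probability_ballN_le _ a) => //.
- exact: ltW.
- by rewrite mulr_ge0 ?powR_ge0 ?ltW.
- by move=> x [_ []].
apply: nearW => x [Wx [xl /negP]]; rewrite -ltNge => xg.
have := density_le_of_dist (density_ge0 Ph x) u_gt0 (radius_gt0 k) xg (W_micro Wx).
suff -> : (u / (2 ^+ k * rho)) `^ p = t by [].
have -> : u / (2 ^+ k * rho) = H `^ (1 / p) * (2^-1) ^+ k.
  rewrite /rho powRN exprVn; field.
  by rewrite ?gt_eqF ?exprn_gt0 ?powR_gt0.
by rewrite powRM ?powR_ge0// -powRrM div1r mulVf ?gt_eqF// powRr1 ?ltW.
Qed.

Lemma inner_mass : (P (W `&` ballN N a rho) <= (k2 * (H * rho ^+ d))%:E)%E.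
Proof.
rewrite mulrCA; apply: (@probability_ballN_le _ a) => //.
- by apply: measurableI => //; exact: measurable_ballN.
- exact: ltW.
- exact: ltW.
by apply: filterS W_le => x hx [/hx].
Qed.

Let ball_shellE k : W `&` ballN N a (2 ^+ k.+1 * rho) =
  (W `&` ballN N a (2 ^+ k * rho)) `|` shell k.
Proof.
apply/seteqP; split => x.
  move=> [Wx xk]; have [xl|xl] := pselect (ballN N a (2 ^+ k * rho) x).
    by left.
  by right; split.
move=> [[Wx xk]|[Wx [xk _]]]; split => //.
apply: le_trans xk _; rewrite ler_pM2r// exprS ler_peMl ?exprn_ge0//.
by rewrite ler1n.
Qed.

(** The masses of the shells decrease geometrically. *)
Lemma cell_mass_le M : (P (W `&` ballN N a (2 ^+ M * rho)) <=
  (k2 * (1 + 2 ^+ d / (1 - q)) * (H * rho ^+ d))%:E)%E.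
Proof.
have q1 : 0 < 1 - q by rewrite subr_gt0.
apply: (@le_trans _ _
  (k2 * (1 + 2 ^+ d * ((1 - q ^+ M) / (1 - q))) * (H * rho ^+ d))%:E).
  elim: M => [|M IH].
    by rewrite expr0 mul1r subrr mul0r mulr0 addr0 mulr1 inner_mass.
  rewrite ball_shellE (le_trans (measureU2 _ _ _))//.
    by apply: measurableI => //; exact: measurable_ballN.
  rewrite (le_trans (leeD IH (shell_mass M)))// -EFinD lee_fin.
  rewrite le_eqVlt; apply/orP; left; apply/eqP.
  rewrite exprS; field; by rewrite gt_eqF.
rewrite lee_fin ler_pM2r ?mulr_gt0 ?exprn_gt0// ler_pM2l// lerD2l.
rewrite ler_pM2l ?exprn_gt0// ler_pdivrMr// mulVf ?gt_eqF//.
by rewrite lerBlDr lerDl exprn_ge0// ltW.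
Qed.

(** The bound on the inertia is the same for every shell, so that only the number
    of shells matters; this is the source of the logarithm. *)
Lemma cell_inertia_le M :
  (\int[P]_(x in W `&` ballN N a (2 ^+ M * rho)) (N (x - a) `^ r)%:E <=
  (k2 * 2 ^+ d * 2 `^ r * (H * rho ^+ d * rho `^ r) * M.+1%:R)%:E)%E.
Proof.
have mN : measurable_fun setT (fun x : 'rV[R]_d => N (x - a) `^ r : measurableTypeR R).
  apply: (measurableT_comp (measurable_powR r)).
  by apply: measurable_continuous_rV; exact: continuous_ndist.
have mB s : measurable (W `&` ballN N a s).
  by apply: measurableI => //; exact: measurable_ballN.
have Npow x s : N (x - a) <= s -> 0 <= N (x - a) `^ r <= s `^ r.
  move=> xs; rewrite powR_ge0/=; have n0 := norm_ge0 N_norm (x - a).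
  by apply: ge0_ler_powR; rewrite ?nnegrE ?(ltW r_gt0) ?(le_trans n0).
have tr : 1 <= 2 `^ r :> R 
  by have := @ler_powR R 2 (ler1n _ 2) 0 r (ltW r_gt0); rewrite powRr0.
have td : 1 <= 2 ^+ d :> R by rewrite exprn_ege1// ler1n.
have hr0 : 0 <= k2 * (H * rho ^+ d * rho `^ r).
  by rewrite !mulr_ge0 ?powR_ge0 ?exprn_ge0// ltW.
elim: M => [|M IH].
  rewrite expr0 mul1r mulr1.
  apply: (@le_trans _ _ ((rho `^ r)%:E * P (W `&` ballN N a rho))%E).
    apply: integral_le_probability => //; rewrite ?powR_ge0//.
    by move=> x [_ /Npow].
  rewrite (@le_trans _ _ ((rho `^ r)%:E * (k2 * (H * rho ^+ d))%:E)%E)//.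
    by rewrite lee_wpmul2l ?lee_fin ?powR_ge0// inner_mass.
  rewrite -EFinM lee_fin.
  apply: (@le_trans _ _ (1 * (k2 * (H * rho ^+ d * rho `^ r)))).
    by rewrite le_eqVlt; apply/orP; left; apply/eqP; ring.
  apply: (@le_trans _ _ (2 ^+ d * 2 `^ r * (k2 * (H * rho ^+ d * rho `^ r)))).
    by rewrite ler_wpM2r// mulr_ege1.
  by rewrite le_eqVlt; apply/orP; left; apply/eqP; ring.
rewrite ball_shellE ge0_integral_setU//; last 3 first.
- by apply/measurable_EFinP; apply: measurable_funS mN.
- by move=> x _; rewrite lee_fin powR_ge0.
- rewrite disj_set2E; apply/eqP/seteqP; split => // x [[_ xk] [_ [_ nxk]]].
  exact: nxk.
rewrite -(natr1 M.+1) mulrDr EFinD leeD// mulr1.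
rewrite (@le_trans _ _ (((2 ^+ M.+1 * rho) `^ r)%:E * P (shell M))%E)//.
  apply: integral_le_probability => //; rewrite ?powR_ge0//.
  by move=> x [_ [/Npow]].
rewrite (@le_trans _ _ (((2 ^+ M.+1 * rho) `^ r)%:E *
    (k2 * 2 ^+ d * (H * rho ^+ d) * q ^+ M)%:E)%E)//.
  by rewrite lee_wpmul2l ?lee_fin ?powR_ge0// shell_mass.
rewrite -EFinM lee_fin le_eqVlt; apply/orP; left; apply/eqP.
rewrite exprS -mulrA powRM ?(ltW (radius_gt0 M))// (powRM _ _ (ltW rho_gt0)) ?exprn_ge0//.
have e1 : ((2 : R) ^+ M) `^ r * q ^+ M = 1.
  have -> : q = (2 `^ r)^-1.
    by rewrite /q -(powR_inv1 (ler0n R 2)) -powRrM mulN1r powRN.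
  have r2 : (2 : R) `^ r != 0 by rewrite gt_eqF// powR_gt0.
  by rewrite powRX// -exprMn divff// expr1n.
transitivity (2 `^ r * (k2 * 2 ^+ d * (H * rho ^+ d * rho `^ r)) *
  (((2 : R) ^+ M) `^ r * q ^+ M)); first ring.
by rewrite e1; ring.
Qed.

End shells.

(** * The four bounds at a fixed neighbourhood *)

Section bounds.
Context (R : realType) (d : nat) (d_ge1 : (1 <= d)%N).
Context (N : 'rV[R]_d -> R) (N_norm : is_norm N) (r : R) (r_gt0 : 0 < r).
Context (P : probability 'rV[R]_d R) (h : 'rV[R]_d -> R) (Ph : is_density P h).
Context (h_lower : forall rho : R, 0 < rho ->
      exists2 c : R, 0 < c & forall x, N x <= rho -> c <= h x).
Context (alpha : nat -> {fset 'rV[R]_d}).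
Context (alpha_opt : forall n, (1 <= n)%N -> is_optimal_codebook N r P n (alpha n)).
Context (fin : (distortion N r P [fset (0 : 'rV[R]_d)%R]%fset < +oo)%E).
Context (c : R) (c_gt0 : 0 < c).
Context (micro : forall K, compact K -> exists nK : nat,
  forall n : nat, (nK <= n)%N -> forall x, K x ->
  (dist N x [set` alpha n] <=
   (c * n%:R `^ (- (1 / d%:R)) * h x `^ (- (1 / (r + d%:R))))%:E)%E).
Local Notation lam := (lebesgue_rV R d).
Local Notation p := (r + d%:R).

Let d_gt0 : (0 : R) < d%:R. Proof. by rewrite ltr0n. Qed.
Let p_gt0 : 0 < p. Proof. by rewrite ltr_wpDr. Qed.

Lemma codebook_neq0 n : (1 <= n)%N -> alpha n != fset0.
Proof. by move=> n1; have [] := optimal_codebook_finite r_gt0 n1 fin (alpha_opt n1). Qed.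

Lemma h_lower_nbhd K (e : R) : compact K ->
  exists2 m : R, 0 < m & forall x, closed_nbhd N K e x -> m <= h x.
Proof.
move=> cK; have [rho rho0 Krho] := closed_nbhd_bounded N_norm e cK.
by have [m m0 hm] := h_lower rho0; exists m => // x /Krho /hm.
Qed.

(** For large [n], a cell meeting [K] lies near [K], where [h] is at most [H], and
    the micro-macro bound holds at each of its points. *)
Lemma cell_setup K (e m H : R) : compact K -> 0 < e -> 0 < m -> 0 < H ->
  {ae lam, forall x, closed_nbhd N K e x -> m <= h x} ->
  {ae lam, forall x, closed_nbhd N K e x -> h x <= H} ->
  exists n0 : nat, forall n, (n0 <= n)%N ->
  forall a, a \in codebook_on N (alpha n) K ->
  let u := c * n%:R `^ (- (1 / d%:R)) in
  [/\ (1 <= n)%N, a \in alpha n,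
   voronoi N a (alpha n) `<=` ballN N a (3 * (u * m `^ (- (1 / p)))),
   forall x, voronoi N a (alpha n) x -> N (x - a) <= u * h x `^ (- (1 / p)) &
   {ae lam, forall x, voronoi N a (alpha n) x -> h x <= H}].
Proof.
move=> cK e0 m0 H0 hm hH.
have [n0 geo] := cell_geometry d_ge1 N_norm r_gt0 codebook_neq0 c_gt0 micro cK e0 m0 hm.
exists (maxn 1 n0) => n; rewrite geq_max => /andP[n1 n0n] a aK u.
have aa : a \in alpha n by move: aK; rewrite !inE => /andP[].
have [W3 B4 _ mic] := geo n n0n a aK.
have WK : voronoi N a (alpha n) `<=` closed_nbhd N K e.
  move=> x Wx; apply: B4; rewrite /ballN/= (le_trans (W3 _ Wx))// ler_wpM2r//.
    by rewrite !mulr_ge0 ?powR_ge0 ?ltW.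
  by rewrite ler_nat.
split => //.
  by move=> x Wx; move/(voronoiP N _ aa) : (Wx) => ->; apply: mic; exact: WK.
by apply: filterS hH => x hx /WK.
Qed.

(** Shells up to any radius are summed, so any positive lower bound of [h] near [K]
    may serve to bound the cell. *)
Lemma mass_upper : exists2 C : R, 0 < C & forall K (e H : R), compact K ->
  0 < e -> 0 < H -> {ae lam, forall x, closed_nbhd N K e x -> h x <= H} ->
  exists n0 : nat, forall n, (n0 <= n)%N ->
  forall a, a \in codebook_on N (alpha n) K ->
  (n%:R%:E * P (voronoi N a (alpha n)) <= (C * H `^ (r / p))%:E)%E.
Proof.
have [[k1 k2] /= [_ k20 lamb]] := lebesgue_ballN N_norm.
have lamb2 a s : 0 <= s -> (lam (ballN N a s) <= (k2 * s ^+ d)%:E)%E.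
  by move=> s0; have /andP[] := lamb a s s0.
have q1 : 0 < 1 - (2^-1 : R) `^ r by rewrite subr_gt0 powR_half_lt1.
exists (k2 * (1 + 2 ^+ d / (1 - 2^-1 `^ r)) * c ^+ d).
  by rewrite !mulr_gt0 ?exprn_gt0// addr_gt0// divr_gt0// exprn_gt0.
move=> K e H cK e0 H0 hH.
have [m m0 hm] := h_lower_nbhd e cK.
have [n0 setup] := cell_setup cK e0 m0 H0 (nearW _ hm) hH.
exists n0 => n n0n a aK; have [n1 aa W3 Wmic WH] := setup n n0n a aK.
set u := c * _ in W3 Wmic.
have u0 : 0 < u by rewrite mulr_gt0// powR_gt0// ltr0n.
have mW := measurable_voronoi N_norm aa.
have rho0 : 0 < u * H `^ (- (1 / p)) by rewrite mulr_gt0// powR_gt0.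
pose D3 := 3 * (u * m `^ (- (1 / p))).
pose M := (Num.truncn (D3 / (u * H `^ (- (1 / p))))).+1.
have MD : D3 <= 2 ^+ M * (u * H `^ (- (1 / p))).
  rewrite -ler_pdivrMr// (le_trans (ltW (truncnS_gt _)))//.
  by rewrite -natrX ler_nat ltnW// ltn_expl.
have := cell_mass_le N_norm r_gt0 Ph k20 lamb2 mW u0 H0 Wmic WH M.
rewrite setIidl; last by move=> x /W3; rewrite /ballN/= => /le_trans; apply.
move=> mass; rewrite (@le_trans _ _ (n%:R%:E * _)%E _ _ (lee_wpmul2l _ mass))//.
rewrite -EFinM lee_fin le_eqVlt; apply/orP; left; apply/eqP.
have [A0 nA nA' _] := nat_root_split r_gt0 d_ge1 n1.
have [B0 HB HB' HB''] := root_split d r_gt0 H0.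
rewrite HB'' HB' {1}nA {1}HB /u nA'.
move: A0 B0; set A := n%:R `^ _; set B := H `^ _ => A0 B0.
rewrite !exprMn !exprVn; field.
by rewrite !expf_neq0 ?gt_eqF.
Qed.

(** The shells needed to cover the cell range over radii from
    [u H^(-1/(r+d))] to [3 u m^(-1/(r+d))], with [u = c n^(-1/d)]. *)
Lemma inertia_upper : exists2 C : R, 0 < C & forall K (e m H : R), compact K ->
  0 < e -> 0 < m -> m <= H ->
  {ae lam, forall x, closed_nbhd N K e x -> m <= h x} ->
  {ae lam, forall x, closed_nbhd N K e x -> h x <= H} ->
  exists n0 : nat, forall n, (n0 <= n)%N ->
  forall a, a \in codebook_on N (alpha n) K ->
  ((n%:R `^ (1 + r / d%:R))%:E * cell_inertia N r P a (alpha n) <=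
    (C * (1 + ln (H / m)))%:E)%E.
Proof.
have [[k1 k2] /= [_ k20 lamb]] := lebesgue_ballN N_norm.
have lamb2 a s : 0 <= s -> (lam (ballN N a s) <= (k2 * s ^+ d)%:E)%E.
  by move=> s0; have /andP[] := lamb a s s0.
have l2 : 0 < ln (2 : R) by rewrite ln_gt0// ltr1n.
have l3 : 0 < ln (3 : R) by rewrite ln_gt0// ltr1n.
pose L : R := 2 + ln 3 / ln 2 + 1 / p / ln 2.
have L0 : 0 < L by rewrite !addr_gt0 ?divr_gt0.
pose C1 := k2 * 2 ^+ d * 2 `^ r * (c ^+ d * c `^ r).
have C10 : 0 < C1 by rewrite !mulr_gt0 ?exprn_gt0 ?powR_gt0.
exists (C1 * L); first by rewrite mulr_gt0.
move=> K e m H cK e0 m0 mH hm hH; have H0 := lt_le_trans m0 mH.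
have [n0 setup] := cell_setup cK e0 m0 H0 hm hH.
exists n0 => n n0n a aK; have [n1 aa W3 Wmic WH] := setup n n0n a aK.
set u := c * _ in W3 Wmic.
have u0 : 0 < u by rewrite mulr_gt0// powR_gt0// ltr0n.
have mW := measurable_voronoi N_norm aa.
have Hm1 : 1 <= H / m by rewrite ler_pdivlMr// mul1r.
have Hmp : 1 <= (H / m) `^ (1 / p).
  have := @ler_powR R _ Hm1 0 (1 / p); rewrite powRr0; apply.
  by rewrite divr_ge0// ltW.
have [|M [M1 M2]] := @log2_choice R (3 * (H / m) `^ (1 / p)).
  by rewrite mulr_ege1// ler1n.
have MD : 3 * (u * m `^ (- (1 / p))) <= 2 ^+ M * (u * H `^ (- (1 / p))).
  have -> : 3 * (u * m `^ (- (1 / p))) =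
      3 * (H / m) `^ (1 / p) * (u * H `^ (- (1 / p))).
    have [B0 _ HB' _] := root_split d r_gt0 H0.
    have [b0 _ mb' _] := root_split d r_gt0 m0.
    rewrite powRM ?invr_ge0 ?(ltW H0) ?(ltW m0)//.
    rewrite -(powR_inv1 (ltW m0)) -powRrM mulN1r HB' mb'.
    by field; rewrite !gt_eqF.
  by rewrite ler_wpM2r// mulr_ge0 ?powR_ge0 ?(ltW u0).
have := cell_inertia_le N_norm r_gt0 Ph k20 lamb2 mW u0 H0 Wmic WH M.
rewrite setIidl; last by move=> x /W3; rewrite /ballN/= => /le_trans; apply.
move=> iner; rewrite (@le_trans _ _ ((n%:R `^ (1 + r / d%:R))%:E * _)%E _ _
  (lee_wpmul2l _ iner))// ?lee_fin ?powR_ge0//.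
apply: (@le_trans _ _ (C1 * M.+1%:R)).
  rewrite le_eqVlt; apply/orP; left; apply/eqP.
  have [A0 nA nA' nA''] := nat_root_split r_gt0 d_ge1 n1.
  have [B0 HB HB' HB''] := root_split d r_gt0 H0.
  rewrite nA'' HB' {1}HB /u nA' /C1.
  move: A0 B0; set A := n%:R `^ _; set B := H `^ _ => A0 B0.
  have -> : (c * A^-1 * B^-1) `^ r = c `^ r / A `^ r / B `^ r.
    by rewrite !powRM ?powRV ?mulr_ge0 ?invr_ge0 ?(ltW c_gt0) ?(ltW A0) ?(ltW B0).
  rewrite !exprMn !exprVn.
  have [Ad Bd] : 0 < A ^+ d /\ 0 < B ^+ d by rewrite !exprn_gt0.
  have [Ar Br] : 0 < A `^ r /\ 0 < B `^ r by split; exact: powR_gt0.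
  move: Ad Bd Ar Br (2 `^ r) (2 ^+ d) (c `^ r) (c ^+ d) (M.+1%:R).
  move: (A ^+ d) (B ^+ d) (A `^ r) (B `^ r) => x y z t x0 y0 z0 t0 *.
  by field; rewrite !gt_eqF.
rewrite -mulrA ler_pM2l// -natr1.
have lnx : ln (3 * (H / m) `^ (1 / p)) = ln 3 + 1 / p * ln (H / m).
  have y0 : 0 < (H / m) `^ (1 / p) by apply: powR_gt0; rewrite divr_gt0.
  have t0 : (3 : R) \is Num.pos by rewrite posrE.
  by rewrite (lnM t0 y0) ln_powR.
have lHm : 0 <= ln (H / m) by rewrite ln_ge0.
rewrite lnx in M2; rewrite (le_trans (lerD M2 (lexx 1)))//.
rewrite /L; have lp : 0 <= 1 / p / ln 2 by rewrite !divr_ge0 ?ltW.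
have l32 : 0 <= ln 3 / ln 2 :> R by rewrite divr_ge0 ?ltW.
have -> : (ln 3 + 1 / p * ln (H / m)) / ln 2 =
  ln 3 / ln 2 + 1 / p / ln 2 * ln (H / m) by rewrite mulrDl; congr (_ + _); ring.
move: (ln 3 / ln 2) (1 / p / ln 2) (ln (H / m)) l32 lp lHm => x y z x0 y0 z0.
nra.
Qed.

(** Removing [a] costs at least the order of [n^(-(1+r/d))], and at most the mass of
    the open cell times [(8 D)^r], because another codebook point lies within
    [5 D] of [a] and the cell has radius at most [3 D]. *)
Lemma mass_lower : exists2 C : R, 0 < C & forall K (e m : R), compact K ->
  0 < e -> 0 < m -> {ae lam, forall x, closed_nbhd N K e x -> m <= h x} ->
  exists n0 : nat, forall n, (n0 <= n)%N ->
  forall a, a \in codebook_on N (alpha n) K ->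
  ((C * m `^ (r / p))%:E <= n%:R%:E * P (open_voronoi N a (alpha n)))%E.
Proof.
have [c0 c00 gain] := open_voronoi_mass d_ge1 N_norm r_gt0 Ph h_lower alpha_opt fin.
exists (c0 / (8 `^ r * c `^ r)).
  by rewrite divr_gt0// mulr_gt0 ?powR_gt0.
move=> K e m cK e0 m0 hm.
have [n0 geo] := cell_geometry d_ge1 N_norm r_gt0 codebook_neq0 c_gt0 micro cK e0 m0 hm.
exists (maxn 2 n0) => n; rewrite geq_max => /andP[n2 n0n] a aK.
have n1 : (1 <= n)%N by exact: ltnW.
have aa : a \in alpha n by move: aK; rewrite !inE => /andP[].
have [W3 _ [b [ba bna ab]] _] := geo n n0n a aK.
set D := c * _ * _ in W3 ab.
have D0 : 0 < D by rewrite !mulr_gt0// powR_gt0// ltr0n.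
have a0 : (alpha n `\ a)%fset != fset0 by apply/fset0Pn; exists b; rewrite !inE bna.
have D8 x : open_voronoi N a (alpha n) x -> distR N (alpha n `\ a)%fset x <= 8 * D.
  move=> /(open_voronoi_sub aa) /W3; rewrite /ballN/= => xa.
  have : distR N (alpha n `\ a)%fset x <= N (x - b).
    by apply: distR_le; rewrite !inE bna.
  by have := normN_tri N_norm a x b; lra.
have D80 : 0 <= 8 * D by rewrite mulr_ge0// ltW.
have := gain n (8 * D) a n2 aa a0 D80 D8.
have mW := measurable_open_voronoi N_norm a0.
have Pfin : P (open_voronoi N a (alpha n)) \is a fin_num by exact: fin_num_measure.
rewrite -(fineK Pfin) -!EFinM !lee_fin.
move: (fine _) => w.
have [A0 nA nA' nA''] := nat_root_split r_gt0 d_ge1 n1.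
have [B0 mB mB' mB''] := root_split d r_gt0 m0.
rewrite (_ : n%:R * w = n%:R `^ (1 / d%:R) ^+ d * w); last by rewrite -nA.
rewrite powRN nA'' mB'' /D nA' mB'.
move: A0 B0; set A := n%:R `^ _; set B := m `^ _ => A0 B0.
have -> : (8 * (c * A^-1 * B^-1)) `^ r = 8 `^ r * (c `^ r / A `^ r / B `^ r).
  by rewrite !powRM ?powRV ?mulr_ge0 ?invr_ge0 ?(ltW c_gt0) ?(ltW A0) ?(ltW B0).
have [Ad Ar Br] : [/\ 0 < A ^+ d, 0 < A `^ r & 0 < B `^ r].
  by split; [exact: exprn_gt0|exact: powR_gt0|exact: powR_gt0].
have [cr er] : 0 < c `^ r /\ (0 : R) < 8 `^ r by split; exact: powR_gt0.
move: Ad Ar Br cr er.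
move: (A ^+ d) (A `^ r) (B `^ r) (c `^ r) (8 `^ r) => x y z s t x0 y0 z0 s0 t0 hw.
have k0 : 0 < x * y * z / (t * s) by rewrite divr_gt0 ?mulr_gt0.
have := ler_wpM2l (ltW k0) hw.
have -> : x * y * z / (t * s) * (c0 * (x * y)^-1) = c0 / (t * s) * z.
  by field; rewrite !gt_eqF.
suff -> : x * y * z / (t * s) * (t * (s / y / z) * w) = x * w by [].
by field; rewrite !gt_eqF.
Qed.

(** A cell whose mass is at least [t] keeps the mass [t/2] away from a ball of
    radius of order [(t/H)^(1/d)] around its centre. This gives the exponent
    [r/d], which is at most [max 1 r]. *)
Lemma inertia_lower : exists2 C : R, 0 < C & forall K (e m H : R), compact K ->
  0 < e -> 0 < m -> m <= H ->
  {ae lam, forall x, closed_nbhd N K e x -> m <= h x} ->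
  {ae lam, forall x, closed_nbhd N K e x -> h x <= H} ->
  exists n0 : nat, forall n, (n0 <= n)%N ->
  forall a, a \in codebook_on N (alpha n) K ->
  ((C * (m / H) `^ (Num.max 1 r))%:E <=
   (n%:R `^ (1 + r / d%:R))%:E * cell_inertia N r P a (alpha n))%E.
Proof.
have [C3 C30 mlow] := mass_lower.
have [[k1 k2] /= [_ k20 lamb]] := lebesgue_ballN N_norm.
have lamb2 a s : 0 <= s -> (lam (ballN N a s) <= (k2 * s ^+ d)%:E)%E.
  by move=> s0; have /andP[] := lamb a s s0.
exists (C3 / 2 * (C3 / (2 * k2)) `^ (r / d%:R)).
  by rewrite !mulr_gt0 ?powR_gt0 ?divr_gt0 ?mulr_gt0.
move=> K e m H cK e0 m0 mH hm hH; have H0 := lt_le_trans m0 mH.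
have [n0 low] := mlow K e m cK e0 m0 hm.
have [n0' setup] := cell_setup cK e0 m0 H0 hm hH.
exists (maxn n0 n0') => n; rewrite geq_max => /andP[n0n n0n'] a aK.
have {}low := low n n0n a aK.
have [n1 aa _ _ WH] := setup n n0n' a aK.
set W := voronoi N a (alpha n) in WH.
have mW : measurable W := measurable_voronoi N_norm aa.
have [A0 nA nA' nA''] := nat_root_split r_gt0 d_ge1 n1.
have [B0 mB mB' mB''] := root_split d r_gt0 m0.
have n0R : (0 : R) < n%:R by rewrite ltr0n.
pose t := C3 * m `^ (r / p) / n%:R.
have t0 : 0 < t by rewrite divr_gt0// mulr_gt0// powR_gt0.
have tW : (t%:E <= P W)%E.
  have PWo : (P (open_voronoi N a (alpha n)) <= P W)%E.
    have [ao|an] := eqVneq (alpha n `\ a)%fset fset0; last first.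
      apply: le_measure; rewrite ?inE//; last exact: open_voronoi_sub.
      exact: measurable_open_voronoi.
    apply: le_measure; rewrite ?inE//; last exact: open_voronoi_sub.
    rewrite (_ : open_voronoi _ _ _ = setT)//.
    apply/seteqP; split => // x _; rewrite /open_voronoi/= setD1_fsetD1 ao.
    rewrite /dist (_ : [set _ | _ in _] = set0) ?ereal_inf0 ?ltry//.
    by apply/seteqP; split => // y [b]; rewrite /= inE.
  rewrite (le_trans _ PWo)// /t mulrC EFinM lee_pdivrMl//.
(* a ball of radius s carries at most half of the mass of the cell *)
pose s := (t / (2 * H * k2)) `^ (1 / d%:R).
have s0 : 0 < s by rewrite powR_gt0// divr_gt0// !mulr_gt0.
have sd : s ^+ d = t / (2 * H * k2).
  rewrite -(powR_mulrn d (ltW s0)) /s -powRrM div1r mulVf ?(gt_eqF d_gt0)//.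
  by rewrite powRr1// divr_ge0 ?(ltW t0)// ltW// !mulr_gt0.
have mB1 := measurable_ballN N_norm a s.
have PB : (P (W `&` ballN N a s) <= (t / 2)%:E)%E.
  rewrite (_ : t / 2 = H * (k2 * s ^+ d)); last first.
    by rewrite sd; field; rewrite !gt_eqF.
  apply: (probability_ballN_le N_norm Ph lamb2 (a := a)) => //.
  - exact: measurableI.
  - exact: ltW.
  - exact: ltW.
  by apply: filterS WH => x hx [/hx].
have mWB : measurable (W `\` ballN N a s) by exact: measurableD.
have PD : ((t / 2)%:E <= P (W `\` ballN N a s))%E.
  have : (P W <= P (W `&` ballN N a s) + P (W `\` ballN N a s))%E.
    rewrite -[in leLHS](setUIDK W (ballN N a s)) measureU2//.
    exact: measurableI.
  move=> /(le_trans tW) h1.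
  have Pfin : P (W `\` ballN N a s) \is a fin_num by exact: fin_num_measure.
  have {h1} := le_trans h1 (leeD PB (lexx _)).
  move: Pfin; case: (P (W `\` ballN N a s)) => //= w _.
  exact: lee_half.
have iner : ((s `^ r * (t / 2))%:E <= cell_inertia N r P a (alpha n))%E.
  have mN : measurable_fun setT (fun x : 'rV[R]_d => N (x - a) `^ r : measurableTypeR R).
    apply: (measurableT_comp (measurable_powR r)).
    by apply: measurable_continuous_rV; exact: continuous_ndist.
  apply: (@le_trans _ _ (\int[P]_(x in W `\` ballN N a s) (N (x - a) `^ r)%:E)%E).
    apply: (@le_trans _ _ ((s `^ r)%:E * P (W `\` ballN N a s))%E).
      by rewrite EFinM lee_wpmul2l// lee_fin powR_ge0.
    apply: probability_le_integral => //; last exact: powR_ge0.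
    move=> x [_ /negP]; rewrite -ltNge => sx.
    by apply: ge0_ler_powR; rewrite ?nnegrE ?norm_ge0// ltW.
  apply: ge0_subset_integral => //.
  - by apply/measurable_EFinP; apply: measurable_funS mN.
  - by move=> x _; rewrite lee_fin powR_ge0.
apply: (le_trans _ (lee_wpmul2l _ iner)); last by rewrite lee_fin powR_ge0.
rewrite -EFinM lee_fin.
have mH01 : 0 < m / H <= 1 by rewrite divr_gt0// ler_pdivrMr// mul1r.
apply: (@le_trans _ _ (C3 / 2 * (C3 / (2 * k2)) `^ (r / d%:R) * (m / H) `^ (r / d%:R))).
  apply: ler_wpM2l; first by rewrite mulr_ge0 ?powR_ge0// divr_ge0// ltW.
  apply: ger_powR => //; rewrite le_max; apply/orP; right.
  by rewrite ler_pdivrMr// ler_peMr ?ler1n// ltW.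
rewrite le_eqVlt; apply/orP; left; apply/eqP.
have sr : s `^ r = (C3 / (2 * k2)) `^ (r / d%:R) *
    (m `^ (r / p) / H) `^ (r / d%:R) * (n%:R `^ (r / d%:R))^-1.
  rewrite /s -powRrM mulrAC mul1r.
  have Ck : 0 <= C3 / (2 * k2) by rewrite divr_ge0 ?mulr_ge0 ?(ltW C30) ?(ltW k20).
  have mpH : 0 <= m `^ (r / p) / H by rewrite divr_ge0 ?powR_ge0 ?(ltW H0).
  rewrite -(powRV _ (ler0n R n)) -(powRM _ Ck mpH).
  rewrite -(powRM _ (mulr_ge0 Ck mpH)) ?invr_ge0 ?ler0n//.
  by congr (_ `^ _); rewrite /t; field; rewrite !gt_eqF.
have mm : m `^ (r / p) * (m `^ (r / p) / H) `^ (r / d%:R) = (m / H) `^ (r / d%:R).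
  have Hi0 : 0 <= H^-1 by rewrite invr_ge0 ltW.
  rewrite (powRM _ (powR_ge0 m (r / p)) Hi0) (powRM _ (ltW m0) Hi0) mulrA.
  congr (_ * _).
  rewrite -powRrM -powRD; last by rewrite (gt_eqF m0) implybT.
  by congr (_ `^ _); field; rewrite !gt_eqF.
rewrite sr -mm powRD; last by rewrite (gt_eqF n0R) implybT.
rewrite powRr1 ?ler0n// /t; field.
by rewrite !gt_eqF// powR_gt0.
Qed.

End bounds.

(** * Upper and lower limits, essential bounds *)

Section limits.
Context (R : realType).
Local Open Scope ereal_scope.
Implicit Types (u : (\bar R)^nat) (l : \bar R).

Lemma limn_esup_le u l : (exists n0 : nat, forall n, (n0 <= n)%N -> u n <= l) ->
  limn_esup u <= l.
Proof.
move=> [n0 un]; rewrite /limn_esup /limf_esup.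
apply: (@le_trans _ _ (ereal_sup (u @` [set n | (n0 <= n)%N]))).
  by apply: ereal_inf_lbound; exists [set n | (n0 <= n)%N] => //; exists n0.
by apply: ge_ereal_sup => _ [n /= nn <-]; exact: un.
Qed.

Lemma le_limn_einf u l : (exists n0 : nat, forall n, (n0 <= n)%N -> l <= u n) ->
  l <= limn_einf u.
Proof.
move=> [n0 un]; rewrite /limn_einf leeNr; apply: limn_esup_le.
by exists n0 => n nn; rewrite leeN2 un.
Qed.

Lemma scale_bigmaxe_le (I : eqType) (s : seq I) (f : I -> \bar R) (y l : R) :
  (0 < y)%R -> (forall i, i \in s -> y%:E * f i <= l%:E) ->
  y%:E * \big[maxe/-oo]_(i <- s) f i <= l%:E.
Proof.
move=> y0 fl; rewrite -lee_pdivlMl//.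
have {}fl i : i \in s -> f i <= y^-1%:E * l%:E.
  by move=> /fl; rewrite -lee_pdivlMl.
elim: s fl => [|i s IH] fl; first by rewrite big_nil leNye.
rewrite big_cons ge_max fl ?mem_head//= IH// => j js.
by rewrite fl// inE js orbT.
Qed.

Lemma le_scale_bigmine (I : eqType) (s : seq I) (f : I -> \bar R) (y l : R) :
  (0 < y)%R -> (forall i, i \in s -> l%:E <= y%:E * f i) ->
  l%:E <= y%:E * \big[mine/+oo]_(i <- s) f i.
Proof.
move=> y0 fl; rewrite -lee_pdivrMl//.
have {}fl i : i \in s -> y^-1%:E * l%:E <= f i.
  by move=> /fl; rewrite -lee_pdivrMl.
elim: s fl => [|i s IH] fl; first by rewrite big_nil leey.
rewrite big_cons le_min fl ?mem_head//= IH// => j js.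
by rewrite fl// inE js orbT.
Qed.

Lemma scale_ereal_sup_le (S : set (\bar R)) (c : R) l : (0 < c)%R ->
  (forall x, S x -> c%:E * x <= l) -> c%:E * ereal_sup S <= l.
Proof.
move=> c0 Sl; rewrite -lee_pdivlMl//; apply: ge_ereal_sup => x Sx.
by rewrite lee_pdivlMl// Sl.
Qed.

End limits.

Section essential_bounds.
Context (R : realType) (d : nat).
Context (N : 'rV[R]_d -> R) (N_norm : is_norm N) (h : 'rV[R]_d -> R).
Local Notation lam := (lebesgue_rV R d).
Implicit Types (K B : set 'rV[R]_d) (e : R).

Lemma ess_sup_onP B (y : R) : (ess_sup_on B h <= y%:E)%E ->
  {ae lam, forall x, B x -> h x <= y}.
Proof.
move=> /ess_supP; apply: filterS => x hx Bx; move: hx.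
by rewrite /patch mem_set//= lee_fin.
Qed.

Lemma ess_inf_onP B (y : R) : (y%:E <= ess_inf_on B h)%E ->
  {ae lam, forall x, B x -> y <= h x}.
Proof.
move=> /ess_infP; apply: filterS => x hx Bx; move: hx.
by rewrite /patch mem_set//= lee_fin.
Qed.

Lemma ess_inf_on_ge B (y : R) : (forall x, B x -> y <= h x) ->
  (y%:E <= ess_inf_on B h)%E.
Proof.
move=> yh; apply/ess_infP; apply: nearW => x; rewrite /patch.
by case: ifPn => [/set_mem Bx|_]; rewrite ?leey//= lee_fin yh.
Qed.

(** Balls around a point of [K] have positive measure, so arbitrarily close to it
    there are points at which [h] lies between its essential bounds. *)
Lemma ess_on_between K e z (s : R) : K z -> 0 < s -> s <= e ->
  exists2 x, N (x - z) <= s & (ess_inf_on (closed_nbhd N K e) h <= (h x)%:E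
    <= ess_sup_on (closed_nbhd N K e) h)%E.
Proof.
move=> Kz s0 se; set B := closed_nbhd N K e.
have : {ae lam, forall x,
    (ess_inf lam (patch (cst +oo) B (EFin \o h)) <= patch (cst +oo) B (EFin \o h) x)%E /\
    (patch (cst -oo) B (EFin \o h) x <= ess_sup lam (patch (cst -oo) B (EFin \o h)))%E}.
  by near=> x; split; near: x; [exact: ess_inf_le|exact: ess_sup_ge].
move=> /(ae_ballN_ex N_norm z s0)[x xz [xi xs]]; exists x => //.
have Bx : B x by apply: (closed_nbhdI Kz); exact: le_trans se.
move: xi xs; rewrite /patch mem_set//= => xi xs.
by apply/andP; split.
Unshelve. all: by end_near. Qed.

Context (h_lower : forall rho : R, 0 < rho ->
      exists2 c : R, 0 < c & forall x, N x <= rho -> c <= h x).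

Lemma ess_on_spec K e : compact K -> K !=set0 -> 0 < e ->
  exists2 m : R, 0 < m & ess_inf_on (closed_nbhd N K e) h = m%:E /\
    (m%:E <= ess_sup_on (closed_nbhd N K e) h)%E.
Proof.
move=> cK [z Kz] e0.
have [m m0 hm] := h_lower_nbhd N_norm h_lower e cK.
have [x _ /andP[xi xs]] := ess_on_between Kz e0 (lexx e).
have := ess_inf_on_ge hm; move: xi xs.
case: (ess_inf_on _ _) => [m'| |]//= xi xs; rewrite lee_fin => mm'.
by exists m'; [exact: lt_le_trans mm'|split; [|exact: le_trans xs]].
Qed.

Lemma ess_sup_on_ge K : K !=set0 ->
  exists2 m : R, 0 < m & forall e, 0 < e ->
    (m%:E <= ess_sup_on (closed_nbhd N K e) h)%E.
Proof.
move=> [z Kz].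
have Nz0 : 0 < N z + 1 by rewrite ltr_wpDl// norm_ge0.
have [m m0 hm] := h_lower Nz0.
exists m => // e e0.
have s0 : 0 < Num.min e 1 by rewrite lt_min e0/=.
have se : Num.min e 1 <= e by rewrite ge_min lexx.
have [x xz /andP[_ xs]] := ess_on_between Kz s0 se.
rewrite (le_trans _ xs)// lee_fin hm//.
rewrite -(subrK z x) (le_trans (norm_triangle N_norm _ _))// addrC lerD2l.
by rewrite (le_trans xz)// ge_min lexx orbT.
Qed.

End essential_bounds.

Theorem theorem4p1 (R : realType) (d : nat) (d_ge1 : (1 <= d)%N)
    (N : 'rV[R]_d -> R) (N_norm : is_norm N)
    (r : R) (r_gt0 : 0 < r)
    (P : probability 'rV[R]_d R) (h : 'rV[R]_d -> R) (Ph : is_density P h)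
    (P_moment : exists2 delta : R, 0 < delta &
      (\int[P]_x (N x `^ (r + delta))%:E < +oo)%E)
    (h_lower : forall rho : R, 0 < rho ->
      exists2 c : R, 0 < c & forall x, N x <= rho -> c <= h x)
    (alpha : nat -> {fset 'rV[R]_d})
    (alpha_opt : forall n, (1 <= n)%N -> is_optimal_codebook N r P n (alpha n))
    (micro_macro : exists2 c21 : R, 0 < c21 &
      forall K : set 'rV[R]_d, compact K ->
      exists nK : nat, forall n : nat, (nK <= n)%N -> forall x, K x ->
        (dist N x [set` alpha n] <=
         (c21 * n%:R `^ (- (1 / d%:R)) * h x `^ (- (1 / (r + d%:R))))%:E)%E) :
  exists c22 c23 c24 c25 : R,
    [/\ 0 < c22, 0 < c23, 0 < c24, 0 < c25 &
     forall K : set 'rV[R]_d, compact K -> K !=set0 ->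
     [/\ (limn_esup (fun n => n%:R%:E *
            \big[maxe/-oo]_(a <- codebook_on N (alpha n) K)
              P (voronoi N a (alpha n))) <=
          c22%:E *
          (ereal_inf [set ess_sup_on (closed_nbhd N K e) h
                     | e in [set e : R | (0 < e)%R]]) `^ (r / (r + d%:R))%R)%E,
         (limn_esup (fun n => (n%:R `^ (1 + r / d%:R))%:E *
            \big[maxe/-oo]_(a <- codebook_on N (alpha n) K)
              cell_inertia N r P a (alpha n)) <=
          c23%:E *
          (1 + lne (ereal_inf [set ess_sup_on (closed_nbhd N K e) h /
                                   ess_inf_on (closed_nbhd N K e) h
                              | e in [set e : R | (0 < e)%R]])))%E,
         (c24%:E *
          ereal_sup [set (ess_inf_on (closed_nbhd N K e) h) `^ (r / (r + d%:R))%R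
                    | e in [set e : R | (0 < e)%R]] <=
          limn_einf (fun n => n%:R%:E *
            \big[mine/+oo]_(a <- codebook_on N (alpha n) K)
              P (open_voronoi N a (alpha n))))%E &
         (c25%:E *
          ereal_sup [set (ess_inf_on (closed_nbhd N K e) h /
                          ess_sup_on (closed_nbhd N K e) h) `^ (Num.max 1 r)%R
                    | e in [set e : R | (0 < e)%R]] <=
          limn_einf (fun n => (n%:R `^ (1 + r / d%:R))%:E *
            \big[mine/+oo]_(a <- codebook_on N (alpha n) K)
              cell_inertia N r P a (alpha n)))%E]].
Proof.
have fin := distortion_fset1_lty N_norm r_gt0 P_moment.
have [c c0 micro] := micro_macro.
have [C22 C220 up_mass] := mass_upper d_ge1 N_norm r_gt0 Ph h_lower alpha_opt fin c0 micro.
have [C23 C230 up_iner] := inertia_upper d_ge1 N_norm r_gt0 Ph alpha_opt fin c0 micro.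
have [C24 C240 low_mass] := mass_lower d_ge1 N_norm r_gt0 Ph h_lower alpha_opt fin c0 micro.
have [C25 C250 low_iner] := inertia_lower d_ge1 N_norm r_gt0 Ph h_lower alpha_opt fin c0 micro.
have p0 : 0 < r + d%:R by rewrite ltr_wpDr.
have q0 : 0 < r / (r + d%:R) by rewrite divr_gt0.
have ln2 : 0 < ln (2 : R) by rewrite ln_gt0// ltr1n.
exists (C22 * 2 `^ (r / (r + d%:R))), (C23 * (1 + ln 2)), C24, C25.
split => //; [by rewrite mulr_gt0// powR_gt0|by rewrite mulr_gt0// addr_gt0|].
move=> K cK K0; split.
- set I := ereal_inf _.
  have [m m0 mI] := ess_sup_on_ge N_norm h_lower K0.
  have {mI} : (m%:E <= I)%E by apply: le_ereal_inf_tmp => _ [e /= e0 <-]; exact: mI.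
  case EI : I => [i| |]//= mi; last first.
    by rewrite gt_eqF// gt0_muley ?leey// lte_fin mulr_gt0// powR_gt0.
  rewrite lee_fin in mi; have i0 : 0 < i := lt_le_trans m0 mi.
  (* the infimum is positive, so a factor 2 in the constant replaces it by the
     value at one neighbourhood *)
  have /ereal_inf_lt[_ [e /= e0 <-] He] : (I < (2 * i)%:E)%E.
    by rewrite EI lte_fin; lra.
  have H0 : 0 < 2 * i by rewrite mulr_gt0.
  have [n0 n0P] := up_mass K e (2 * i) cK e0 H0 (ess_sup_onP (ltW He)).
  apply: limn_esup_le; exists (maxn 1 n0) => n; rewrite geq_max => /andP[n1 n0n].
  rewrite -EFinM; apply: scale_bigmaxe_le => [|a aK]; first by rewrite ltr0n.
  by rewrite (le_trans (n0P n n0n a aK))// powRM ?(ltW i0)// mulrA.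
- set J := ereal_inf _.
  have J1 : (1 <= J)%E.
    apply: le_ereal_inf_tmp => _ [e /= e0 <-].
    have [m m0 [-> mH]] := ess_on_spec N_norm h_lower cK K0 e0.
    by rewrite inver gt_eqF// lee_pdivlMr// mul1e.
  case EJ : J J1 => [j| |]//= j1; last first.
    by rewrite addey// gt0_muley ?leey// lte_fin mulr_gt0// addr_gt0.
  rewrite lee_fin in j1; have j0 : 0 < j := lt_le_trans ltr01 j1.
  have /ereal_inf_lt[_ [e /= e0 <-]] : (J < (2 * j)%:E)%E.
    by rewrite EJ lte_fin; lra.
  have [m m0 [Em mH]] := ess_on_spec N_norm h_lower cK K0 e0.
  have hm : (m%:E <= ess_inf_on (closed_nbhd N K e) h)%E by rewrite Em.
  rewrite Em inver gt_eqF//; case EH : (ess_sup_on _ _) mH => [H| |]//= mH; last first.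
    by rewrite gt0_mulye// lte_fin invr_gt0.
  rewrite lee_fin in mH; rewrite -EFinM lte_fin => Hm.
  have hH : (ess_sup_on (closed_nbhd N K e) h <= H%:E)%E by rewrite EH.
  have [n0 n0P] := up_iner K e m H cK e0 m0 mH (ess_inf_onP hm) (ess_sup_onP hH).
  apply: limn_esup_le; exists (maxn 1 n0) => n; rewrite geq_max => /andP[n1 n0n].
  rewrite ifF; last by apply/negbTE; rewrite -ltNge.
  rewrite -EFinD -EFinM; apply: scale_bigmaxe_le => [|a aK].
    by rewrite powR_gt0// ltr0n.
  rewrite (le_trans (n0P n n0n a aK))// lee_fin -mulrA ler_pM2l//.
  have lj : 0 <= ln j by rewrite ln_ge0.
  have : ln (H / m) <= ln 2 + ln j.
    rewrite -lnM ?posrE//; rewrite ler_ln ?posrE ?mulr_gt0 ?invr_gt0 ?(lt_le_trans m0 mH)//.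
    exact: ltW.
  by move: (ln _) (ln _) (ln _) lj ln2 => x y z; nra.
- apply: scale_ereal_sup_le => // _ [e /= e0 <-].
  have [m m0 [Em _]] := ess_on_spec N_norm h_lower cK K0 e0.
  have hm : (m%:E <= ess_inf_on (closed_nbhd N K e) h)%E by rewrite Em.
  have [n0 n0P] := low_mass K e m cK e0 m0 (ess_inf_onP hm).
  apply: le_limn_einf; exists (maxn 1 n0) => n; rewrite geq_max => /andP[n1 n0n].
  rewrite Em /= -EFinM; apply: le_scale_bigmine => [|a aK]; first by rewrite ltr0n.
  exact: n0P.
apply: scale_ereal_sup_le => // _ [e /= e0 <-].
have [m m0 [Em mH]] := ess_on_spec N_norm h_lower cK K0 e0.
have hm : (m%:E <= ess_inf_on (closed_nbhd N K e) h)%E by rewrite Em.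
have max0 : Num.max 1 r != 0 by rewrite gt_eqF// lt_max ltr01.
rewrite Em; case EH : (ess_sup_on _ _) mH => [H| |]// mH; last first.
  rewrite invey mule0 poweR0r// mule0; apply: le_limn_einf; exists 1%N => n n1.
  apply: le_scale_bigmine => [|a aK]; first by rewrite powR_gt0// ltr0n.
  by rewrite mule_ge0 ?lee_fin ?powR_ge0// integral_ge0// => x _; rewrite lee_fin powR_ge0.
rewrite lee_fin in mH; have H0 := lt_le_trans m0 mH.
have hH : (ess_sup_on (closed_nbhd N K e) h <= H%:E)%E by rewrite EH.
have [n0 n0P] := low_iner K e m H cK e0 m0 mH (ess_inf_onP hm) (ess_sup_onP hH).
apply: le_limn_einf; exists (maxn 1 n0) => n; rewrite geq_max => /andP[n1 n0n].
have -> : (m%:E / H%:E)%E = (m / H)%:E by rewrite inver gt_eqF.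
rewrite poweR_EFin -EFinM; apply: le_scale_bigmine => [|a aK].
  by rewrite powR_gt0// ltr0n.
exact: n0P.
Qed.
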